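(* Let $d\ge2$ and $H\in(0,1/2]$, and let $X=(X_t)_{t\in\mathbb S^{d-1}}$ be a spherical fractional Brownian motion with Hurst parameter $H$ (jointly measurable version). Then $$|\sigma^{d-1}|^{-1}\int_{\mathbb S^{d-1}}\mathbf 1\{X_s>0\}\,\sigma^{d-1}(ds)$$ is uniformly distributed on $(0,1)$, where $|\sigma^{d-1}|=\sigma^{d-1}(\mathbb S^{d-1})=2\pi^{d/2}/\Gamma(d/2)$.
   Context: $\mathbb S^{d-1}=\{x\in\mathbb R^d:\|x\|=1\}$ is the unit sphere with surface measure $\sigma^{d-1}$ and geodesic distance $d(s,t)$. A spherical fractional Brownian motion with Hurst parameter $H\in(0,1/2]$ is a centred real Gaussian process $(X_t)_{t\in\mathbb S^{d-1}}$ such that $X_O=0$ a.s. for some fixed point $O\in\mathbb S^{d-1}$ and $\mathbb E[(X_s-X_t)^2]=d(s,t)^{2H}$ for all $s,t\in\mathbb S^{d-1}$. *)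

(* Defs.v *)
From HB Require Import structures.
From mathcomp Require Import all_boot all_order all_algebra.
From mathcomp Require Import all_classical all_reals all_analysis.
Set Implicit Arguments. Unset Strict Implicit. Unset Printing Implicit Defensive.
Import Order.TTheory GRing.Theory Num.Theory.
Local Open Scope classical_set_scope.
Local Open Scope ring_scope.

Section SphereDefs.
Variable R : realType.

(** Points of R^d are d-tuples (with the product Borel sigma-algebra). *)
Definition dotR (d : nat) (x y : d.-tuple R) : R :=
  \sum_(i < d) tnth x i * tnth y i.

Definition sphere (d : nat) : set (d.-tuple R) :=
  [set x | dotR x x = 1].

Definition geod (d : nat) (s t : d.-tuple R) : R := acos (dotR s t).

(** Lebesgue measure on R^n (as a set function on n-tuples), defined by
    iterated integration (Tonelli); it is the n-fold product of
    one-dimensional Lebesgue measure on Borel sets. *)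
Fixpoint lebesgue_tuple (n : nat) : set (n.-tuple R) -> \bar R :=
  match n with
  | 0%N => fun A => (\1_A [tuple] : R)%:E
  | m.+1 => fun A =>
      (\int[@lebesgue_measure R]_x @lebesgue_tuple m [set t : m.-tuple R | A (cons_tuple (x : R) t)])%E
  end.

Definition cone (d : nat) (A : set (d.-tuple R)) : set (d.-tuple R) :=
  [set x | exists r : R, 0 < r <= 1 /\
     exists2 s, A s & x = map_tuple (fun y => r * y) s].

Definition surface_measure (d : nat) (A : set (d.-tuple R)) : \bar R :=
  (d%:R%:E * lebesgue_tuple (cone A))%E.

End SphereDefs.
Arguments sphere {R} d.

Section Gaussian.
Context {R : realType} {dO : measure_display} {Omega : measurableType dO}.
Variable P : probability Omega R.

Definition centered_gaussian (Z : Omega -> R) : Prop :=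
  measurable_fun setT Z /\
  exists s : R, 0 <= s /\
    forall B : set R, measurable B ->
      P (Z @^-1` B) = (if s == 0 then \d_(0:R) B else normal_prob 0 s B).

Definition centered_gaussian_process (T : Type) (I : set T)
    (X : Omega -> T -> R) : Prop :=
  forall (n : nat) (t : 'I_n -> T) (a : 'I_n -> R),
    (forall i, I (t i)) ->
    centered_gaussian (fun w => \sum_(i < n) a i * X w (t i)).

Definition spherical_fBm (d : nat) (H : R) (O : d.-tuple R)
    (X : Omega -> d.-tuple R -> R) : Prop :=
  [/\ sphere d O,
      centered_gaussian_process (sphere d) X,
      {ae P, forall w, X w O = 0}
    & forall s t, sphere d s -> sphere d t ->
        (\int[P]_w ((X w s - X w t) ^+ 2)%:E)%E
          = ((geod s t) `^ (2 * H))%:E ].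

Definition positive_fraction (d : nat) (X : Omega -> d.-tuple R -> R)
    (w : Omega) : R :=
  fine (surface_measure [set s | sphere d s /\ 0 < X w s])
  / fine (surface_measure (sphere d)).

End Gaussian.

(* Main.v *)
(** For t on the sphere let G(t) be the fraction of points s with X_s > X_t.
    The positive fraction is G(O) almost surely, because X_O = 0. The
    orthogonal reflection exchanging two points t and t' preserves the surface
    measure and the law of the increments of X, so G(t) and G(t') have the same
    law. Hence P(G(O) > a) is the mean over t of P(G(t) > a), that is, the
    expectation of the fraction of points t with G(t) > a; for a path without
    ties this fraction is 1 - a. Ties X_s = X_t have probability 0 for s <> t.

    The equality of the laws of G(t) and G(t') only uses the one-dimensional
    laws of linear combinations of increments: a class of "multipliers", stable
    under algebraic operations, bounded limits and integration over the sphere,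
    transports the equality of expectations of sines and cosines of these
    combinations to the functionals G(t) and G(t'). *)

Require Import Defs.
From HB Require Import structures.
From mathcomp Require Import all_boot all_order all_algebra.
From mathcomp Require Import all_classical all_reals all_analysis.
From mathcomp Require Import measurable_realfun ring lra.
Set Implicit Arguments.
Unset Strict Implicit.
Unset Printing Implicit Defensive.
Import Order.TTheory GRing.Theory Num.Theory.
Import numFieldNormedType.Exports.
Local Open Scope classical_set_scope.
Local Open Scope ring_scope.

(** * Multipliers *)

(** The law of [G(t)] involves uncountably many values of [X], while the Gaussian hypothesis speaks
    of one linear combination at a time; the classical bridge is through joint laws of finite
    families and a monotone class argument. Multipliers take its place: cosines and sines of linear
    combinations are the real and imaginary parts of characteristic functions, products of them are
    again of this kind, and polynomial approximation of the sign leads to the indicator of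
    [X_s > X_t]. Integration over [s], and then the indicator of [G(t) > a], stay within the class.

    Increments are compared, rather than values, because their variances depend on geodesic distance
    alone, which every reflection preserves, whereas a reflection moves the base point [O].

    Lebesgue measure is given by iterated integrals, which single out the coordinate axes. Its
    invariance under reflections comes from the uniqueness of translation invariant measures, with
    the unit ball fixing the constant. *)

Section BoundedMeasurable.
Context d (T : measurableType d) (R : realType).
Implicit Types f g : T -> R.

Definition bounded_measurable f :=
  measurable_fun setT f /\ exists K, forall x, `|f x| <= K.

Lemma bounded_measurable_cst (c : R) : bounded_measurable (fun=> c).
Proof. by split; [exact: measurable_cst | exists `|c|]. Qed.

Lemma bounded_measurableD f g : bounded_measurable f -> bounded_measurable g ->
  bounded_measurable (fun x => f x + g x).
Proof.
move=> [mf [K fK]] [mg [M gM]]; split; first exact: measurable_funD.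
by exists (K + M) => x; rewrite (le_trans (ler_normD _ _)) ?lerD.
Qed.

Lemma bounded_measurableM f g : bounded_measurable f -> bounded_measurable g ->
  bounded_measurable (fun x => f x * g x).
Proof.
move=> [mf [K fK]] [mg [M gM]]; split; first exact: measurable_funM.
by exists (K * M) => x; rewrite normrM ler_pM.
Qed.

Lemma bounded_measurable_cos f : measurable_fun setT f ->
  bounded_measurable (fun x => cos (f x)).
Proof.
move=> mf; split; last by exists 1 => x; rewrite ler_norml cos_geN1 cos_le1.
apply: (measurableT_comp (f := cos)) => //.
by apply: continuous_measurable_fun; exact: continuous_cos.
Qed.

Lemma bounded_measurable_sin f : measurable_fun setT f ->
  bounded_measurable (fun x => sin (f x)).
Proof.
move=> mf; split; last by exists 1 => x; rewrite ler_norml sin_geN1 sin_le1.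
apply: (measurableT_comp (f := sin)) => //.
by apply: continuous_measurable_fun; exact: continuous_sin.
Qed.

Lemma bounded_measurable_bounded f : bounded_measurable f ->
  [bounded f x | x in setT].
Proof.
move=> [_ [K fK]]; exists K; split; first exact: num_real.
by move=> M KM x _ /=; rewrite (le_trans (fK x))// ltW.
Qed.

Variable P : probability T R.

Lemma bounded_measurable_integrable f : bounded_measurable f ->
  P.-integrable setT (EFin \o f).
Proof.
move=> bf; apply: measurable_bounded_integrable => //.
- by rewrite [ltLHS]probability_setT ltry.
- exact: bf.1.
- exact: bounded_measurable_bounded.
Qed.

Lemma expectation_lin f g (c : R) :
  bounded_measurable f -> bounded_measurable g ->
  \int[P]_x (f x + c * g x) = \int[P]_x f x + c * \int[P]_x g x.
Proof.
move=> bf bg; rewrite RintegralD//; last 2 first.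
- exact: bounded_measurable_integrable.
- by apply: bounded_measurable_integrable;
    apply: bounded_measurableM => //; exact: bounded_measurable_cst.
by rewrite RintegralZl//; exact: bounded_measurable_integrable.
Qed.

Lemma bounded_convergence (f_ : nat -> T -> R) f (K : R) :
  (forall n, measurable_fun setT (f_ n)) -> measurable_fun setT f ->
  (forall n x, `|f_ n x| <= K) ->
  (forall x, f_ n x @[n --> \oo] --> f x) ->
  \int[P]_x f_ n x @[n --> \oo] --> \int[P]_x f x.
Proof.
move=> mf_ mf fK ff.
have [] := @dominated_convergence _ _ _ P setT measurableT
   (fun n x => (f_ n x)%:E) (fun x => (f x)%:E) (fun=> K%:E).
- by move=> n; exact/measurable_EFinP.
- exact/measurable_EFinP.
- by apply: aeW => x _; apply: cvg_EFin; [exact: nearW | exact: ff].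
- exact/(bounded_measurable_integrable (f := fun=> K))/bounded_measurable_cst.
- by apply: aeW => x n _; rewrite lee_fin.
move=> fint _; rewrite /Rintegral -[X in _ --> X -> _]fineK; last first.
  exact: integrable_fin_num.
by move/fine_cvgP => [].
Qed.

End BoundedMeasurable.

(* Iterating x |-> (3 x - x ^ 3) / 2 on [-1, 1] gives polynomials bounded by 1
   that converge pointwise to the sign function: for 0 < x <= 1 the distance
   e := 1 - x to the fixed point 1 is mapped to e * (e * (3 - e) / 2). *)
Section SignIteration.
Variable R : realType.

Definition sign_step (x : R) : R := 3 / 2 * x + - (1 / 2) * (x * (x * x)).

Lemma sign_stepN x : sign_step (- x) = - sign_step x.
Proof. by rewrite /sign_step; ring. Qed.

Lemma sign_step_gt0 x : 0 < x <= 1 -> x <= sign_step x <= 1.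
Proof.
move=> /andP[x0 x1]; rewrite /sign_step.
have h1 : 0 <= x * ((1 - x) * (1 + x)) by rewrite !mulr_ge0//; lra.
have h2 : 0 <= (1 - x) * ((1 - x) * (2 + x)) by rewrite !mulr_ge0//; lra.
by apply/andP; split; lra.
Qed.

Lemma iter_sign_step_gt0 n x : 0 < x <= 1 -> x <= iter n sign_step x <= 1.
Proof.
move=> x01; elim: n => [|n /andP[IH1 IH2]] /=.
  by case/andP: x01 => _ ->; rewrite lexx.
have /sign_step_gt0/andP[h1 ->] : 0 < iter n sign_step x <= 1.
  by rewrite IH2 andbT; case/andP: x01 => x0 _; exact: lt_le_trans IH1.
by rewrite (le_trans IH1).
Qed.

Lemma iter_sign_stepN n x : iter n sign_step (- x) = - iter n sign_step x.
Proof. by elim: n => //= n ->; rewrite sign_stepN. Qed.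

Lemma iter_sign_step0 n : iter n sign_step 0 = 0.
Proof. by elim: n => //= n ->; rewrite /sign_step; ring. Qed.

Lemma iter_sign_step_norm n x : `|x| <= 1 -> `|iter n sign_step x| <= 1.
Proof.
have [x0|x0|->] := ltgtP x 0; last by rewrite iter_sign_step0 normr0.
- rewrite ltr0_norm// => x1; rewrite -(opprK x) iter_sign_stepN normrN.
  have /(iter_sign_step_gt0 n)/andP[h1 h2] : 0 < - x <= 1 by rewrite oppr_gt0 x0.
  by rewrite ger0_norm//; apply: le_trans h1; rewrite oppr_ge0 ltW.
- rewrite gtr0_norm// => x1.
  have /(iter_sign_step_gt0 n)/andP[h1 h2] : 0 < x <= 1 by rewrite x0.
  by rewrite ger0_norm//; apply: le_trans h1; exact: ltW.
Qed.

Lemma cvg_iter_sign_step x : `|x| <= 1 ->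
  iter n sign_step x @[n --> \oo] --> Num.sg x.
Proof.
wlog: x / 0 < x => [wlg|x0].
  have [x0|x0|->] := ltgtP x 0; [|exact: wlg|]; last first.
    by rewrite sgr0 => _; under eq_fun do rewrite iter_sign_step0; exact: cvg_cst.
  move=> x1; rewrite -(opprK x) sgrN; under eq_fun do rewrite iter_sign_stepN.
  by apply: cvgN; apply: wlg; rewrite ?oppr_gt0 ?normrN.
rewrite gtr0_norm// gtr0_sg// => x1.
pose e := 1 - x; pose r := e * (3 - e) / 2.
have r01 : 0 <= r < 1 by rewrite /r /e; apply/andP; split; nra.
(* [r] is the contraction factor at the starting point. The iterates stay above [x] and
   [u * (3 - u) / 2] increases on [[0, 1]], so no later factor is larger. *)
have er n : 1 - iter n sign_step x <= r ^+ n.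
  elim: n => [|n IH] /=; first by rewrite expr0; lra.
  have /(iter_sign_step_gt0 n)/andP[h1 h2] : 0 < x <= 1 by rewrite x0.
  set y := iter n sign_step x in IH h1 h2 *.
  have -> : 1 - sign_step y = (1 - y) * ((1 - y) * (2 + y) / 2).
    by rewrite /sign_step; field.
  rewrite exprSr; apply: ler_pM => //; first by lra.
    by nra.
  by rewrite /r /e; nra.
apply/cvgrPdist_le => eps eps0.
have rn : r ^+ n @[n --> \oo] --> 0.
  by apply: cvg_expr; case/andP: r01 => r0 r1; rewrite ger0_norm.
have /cvgrPdist_le/(_ _ eps0) := rn.
apply: filterS => n; rewrite sub0r normrN => hn.
have /(iter_sign_step_gt0 n)/andP[h1 h2] : 0 < x <= 1 by rewrite x0.
rewrite ger0_norm ?subr_ge0//; apply: le_trans (er n) _.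
exact: le_trans (ler_norm _) hn.
Qed.

(* sin (x / n) has the sign of x as soon as |x| / n < pi. *)
Lemma cvg_sg_sin_div (x : R) :
  Num.sg (sin (n.+1%:R^-1 * x)) @[n --> \oo] --> Num.sg x.
Proof.
wlog: x / 0 < x => [wlg|x0].
  have [x0|x0|->] := ltgtP x 0; [|exact: wlg|]; last first.
    by rewrite sgr0; under eq_fun do rewrite mulr0 sin0 sgr0; exact: cvg_cst.
  rewrite -(opprK x) sgrN; under eq_fun do rewrite mulrN sinN sgrN.
  by apply: cvgN; apply: wlg; rewrite ?oppr_gt0.
apply: (@cvg_near_cst); near=> n.
rewrite [RHS](gtr0_sg x0) gtr0_sg//; apply: sin_gt0_pi; apply/andP; split.
  by rewrite mulr_gt0// invr_gt0.
rewrite mulrC ltr_pdivrMr// mulrC -ltr_pdivrMr ?pi_gt0//.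
apply: (@lt_trans _ _ n%:R); last by rewrite ltr_nat.
by near: n; exact: nbhs_infty_gtr.
Unshelve. all: by end_near. Qed.

End SignIteration.

Section Multipliers.
Context d (T : measurableType d) (R : realType) (P : probability T R).
Implicit Types h k z : T -> R.

(* The pairs (z, z') related by L are corresponding linear functionals of two
   families of random variables with the same one-dimensional marginals. *)
Variable L : (T -> R) -> (T -> R) -> Prop.
Hypothesis L_measurable : forall z z', L z z' ->
  measurable_fun setT z /\ measurable_fun setT z'.
Hypothesis L_law : forall z z', L z z' -> forall B, measurable B ->
  P (z @^-1` B) = P (z' @^-1` B).
Hypothesis L0 : L (fun=> 0) (fun=> 0).
Hypothesis L_lin : forall z z' y y' (c : R), L z z' -> L y y' ->
  L (fun x => z x + c * y x) (fun x => z' x + c * y' x).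

(** Equality of [E[h e^{iz}]] and [E[h' e^{iz'}]], split into real and imaginary parts. *)
Definition trig_equal h h' :=
  [/\ bounded_measurable h, bounded_measurable h' & forall z z', L z z' ->
  \int[P]_x (h x * cos (z x)) = \int[P]_x (h' x * cos (z' x)) /\
  \int[P]_x (h x * sin (z x)) = \int[P]_x (h' x * sin (z' x))].

(** Defined by its action on [trig_equal] pairs, so that a product of multipliers is a composition
    of actions; [trig_equal] itself gives no direct control of products. *)
Definition multiplier k k' :=
  [/\ bounded_measurable k, bounded_measurable k' & forall h h',
  trig_equal h h' ->
  trig_equal (fun x => h x * k x) (fun x => h' x * k' x)].

Lemma equal_law_Rintegral z z' (phi : R -> R) :
  measurable_fun setT z -> measurable_fun setT z' ->
  (forall B, measurable B -> P (z @^-1` B) = P (z' @^-1` B)) ->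
  bounded_measurable phi ->
  \int[P]_x phi (z x) = \int[P]_x phi (z' x).
Proof.
move=> mz mz' zz' bphi; have [mphi [K phiK]] := bphi.
have bc (y : T -> R) : measurable_fun setT y -> bounded_measurable (phi \o y).
  by move=> my; split; [exact: measurableT_comp | exists K => x; exact: phiK].
have push (y : T -> R) : measurable_fun setT y ->
    (\int[P]_x (phi (y x))%:E =
     \int[pushforward P y]_u (phi u)%:E)%E.
  move=> my; rewrite integral_pushforward//.
    exact/measurable_EFinP.
  rewrite preimage_setT; exact: (bounded_measurable_integrable P (bc _ my)).
rewrite /Rintegral push// [in RHS]push//; congr fine.
apply: eq_measure_integral => B mB _; exact: zz'.
Qed.

Lemma trig_equal1 : trig_equal (fun=> 1) (fun=> 1).
Proof.
split; [exact: bounded_measurable_cst | exact: bounded_measurable_cst |].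
move=> z z' zz'; have [mz mz'] := L_measurable zz'.
under eq_Rintegral do rewrite mul1r.
under [in X in _ = X /\ _]eq_Rintegral do rewrite mul1r.
under [in X in _ /\ X = _]eq_Rintegral do rewrite mul1r.
under [in X in _ /\ _ = X]eq_Rintegral do rewrite mul1r.
split; apply: equal_law_Rintegral => //; try exact: L_law.
- exact: (bounded_measurable_cos (f := id)).
- exact: (bounded_measurable_sin (f := id)).
Qed.

(** The action on the constant weight 1, tested against [z = 0]. *)
Lemma multiplier_Rintegral k k' : multiplier k k' ->
  \int[P]_x k x = \int[P]_x k' x.
Proof.
move=> [_ _ /(_ _ _ trig_equal1)[_ _ /(_ _ _ L0)[+ _]]].
by under eq_Rintegral do rewrite mul1r cos0 mulr1;
   under [in X in _ = X -> _]eq_Rintegral do rewrite mul1r cos0 mulr1.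
Qed.

Lemma multiplier_cst (c : R) : multiplier (fun=> c) (fun=> c).
Proof.
split; [exact: bounded_measurable_cst | exact: bounded_measurable_cst |].
move=> h h' [bh bh' hh']; split.
- by apply: bounded_measurableM => //; exact: bounded_measurable_cst.
- by apply: bounded_measurableM => //; exact: bounded_measurable_cst.
move=> z z' zz'; have [mz mz'] := L_measurable zz'.
have [ec es] := hh' _ _ zz'.
have scale (f g : T -> R) : bounded_measurable f -> bounded_measurable g ->
    \int[P]_x (f x * c * g x) = \int[P]_x (f x * g x) * c.
  move=> bf bg; rewrite -RintegralZr//; last first.
    by apply: bounded_measurable_integrable; exact: bounded_measurableM.
  by apply: eq_Rintegral => x _; rewrite mulrAC.
by rewrite !scale ?ec ?es//;
  by [exact: bounded_measurable_cos|exact: bounded_measurable_sin].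
Qed.

Lemma multiplierD k k' l l' : multiplier k k' -> multiplier l l' ->
  multiplier (fun x => k x + l x) (fun x => k' x + l' x).
Proof.
move=> [bk bk' kk'] [bl bl' ll']; split; try exact: bounded_measurableD.
move=> h h' hh'.
have [bhk bhk' hkk'] := kk' _ _ hh'; have [bhl bhl' hll'] := ll' _ _ hh'.
have [bh bh' _] := hh'.
split; try by apply: bounded_measurableM => //; exact: bounded_measurableD.
move=> z z' zz'; have [mz mz'] := L_measurable zz'.
have bcos := bounded_measurable_cos mz; have bcos' := bounded_measurable_cos mz'.
have bsin := bounded_measurable_sin mz; have bsin' := bounded_measurable_sin mz'.
have [ec es] := hkk' _ _ zz'; have [fc fs] := hll' _ _ zz'.
have split_int (f f1 f2 g : T -> R) : bounded_measurable (fun x => f x * f1 x) ->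
    bounded_measurable (fun x => f x * f2 x) -> bounded_measurable g ->
    \int[P]_x (f x * (f1 x + f2 x) * g x) =
    \int[P]_x (f x * f1 x * g x) + \int[P]_x (f x * f2 x * g x).
  move=> b1 b2 bg; rewrite -[X in _ + X]mul1r -expectation_lin.
  - by apply: eq_Rintegral => x _; ring.
  - exact: bounded_measurableM.
  - exact: bounded_measurableM.
by rewrite !split_int// ec es fc fs.
Qed.

Lemma multiplierM k k' l l' : multiplier k k' -> multiplier l l' ->
  multiplier (fun x => k x * l x) (fun x => k' x * l' x).
Proof.
move=> [bk bk' kk'] [bl bl' ll']; split; try exact: bounded_measurableM.
move=> h h' /kk'/ll'.
have -> : (fun x => h x * k x * l x) = (fun x => h x * (k x * l x)).
  by apply/funext => x; rewrite mulrA.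
by have -> : (fun x => h' x * k' x * l' x) = (fun x => h' x * (k' x * l' x));
  first by apply/funext => x; rewrite mulrA.
Qed.

(* By the product formulas, multiplying by sin z shifts the argument of the
   test functions cos y and sin y by z, and L is stable under such shifts. *)
Lemma multiplier_sin z z' : L z z' ->
  multiplier (fun x => sin (z x)) (fun x => sin (z' x)).
Proof.
move=> zz'; have [mz mz'] := L_measurable zz'.
have bsin := bounded_measurable_sin mz; have bsin' := bounded_measurable_sin mz'.
split => // h h' [bh bh' hh'].
split; try exact: bounded_measurableM.
move=> y y' yy'; have [my my'] := L_measurable yy'.
have [cp sp] := hh' _ _ (L_lin 1 yy' zz').
have [cm sm] := hh' _ _ (L_lin (-1) yy' zz').
have mlin (u v : T -> R) (c : R) : measurable_fun setT u ->
    measurable_fun setT v -> measurable_fun setT (fun x => u x + c * v x).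
  by move=> mu mv; apply: measurable_funD => //; exact: measurable_funM.
have sin_cos (f u v : T -> R) : bounded_measurable f ->
    measurable_fun setT u -> measurable_fun setT v ->
    \int[P]_x (f x * sin (v x) * cos (u x)) =
    2^-1 * (\int[P]_x (f x * sin (u x + 1 * v x)) +
            (-1) * \int[P]_x (f x * sin (u x + -1 * v x))).
  move=> bf mu mv.
  have b c : bounded_measurable (fun x => f x * sin (u x + c * v x)).
    by apply: bounded_measurableM => //; apply: bounded_measurable_sin; exact: mlin.
  rewrite -expectation_lin// -RintegralZl//; last first.
    apply: bounded_measurable_integrable; apply: bounded_measurableD => //.
    by apply: bounded_measurableM => //; exact: bounded_measurable_cst.
  by apply: eq_Rintegral => x _; rewrite mul1r mulN1r sinD sinB; field.
have sin_sin (f u v : T -> R) : bounded_measurable f ->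
    measurable_fun setT u -> measurable_fun setT v ->
    \int[P]_x (f x * sin (v x) * sin (u x)) =
    2^-1 * (\int[P]_x (f x * cos (u x + -1 * v x)) +
            (-1) * \int[P]_x (f x * cos (u x + 1 * v x))).
  move=> bf mu mv.
  have b c : bounded_measurable (fun x => f x * cos (u x + c * v x)).
    by apply: bounded_measurableM => //; apply: bounded_measurable_cos; exact: mlin.
  rewrite -expectation_lin// -RintegralZl//; last first.
    apply: bounded_measurable_integrable; apply: bounded_measurableD => //.
    by apply: bounded_measurableM => //; exact: bounded_measurable_cst.
  by apply: eq_Rintegral => x _; rewrite mul1r mulN1r cosB cosD; field.
by split; [rewrite !sin_cos// sp sm | rewrite !sin_sin// cp cm].
Qed.

(** The common bound [K] survives in the limit and allows dominated convergence on both sides of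
    each trigonometric identity. *)
Lemma multiplier_lim (k_ k'_ : nat -> T -> R) k k' (K : R) :
  (forall n, multiplier (k_ n) (k'_ n)) ->
  (forall n x, `|k_ n x| <= K) -> (forall n x, `|k'_ n x| <= K) ->
  (forall x, k_ n x @[n --> \oo] --> k x) ->
  (forall x, k'_ n x @[n --> \oo] --> k' x) ->
  multiplier k k'.
Proof.
move=> mk kK k'K ck ck'.
have lim_bounded (f_ : nat -> T -> R) (f : T -> R) : (forall n, bounded_measurable (f_ n)) ->
    (forall n x, `|f_ n x| <= K) -> (forall x, f_ n x @[n --> \oo] --> f x) ->
    bounded_measurable f.
  move=> bf fK cf; split.
    apply/measurable_EFinP.
    apply: (emeasurable_fun_cvg (fun n x => (f_ n x)%:E)) => [n|x _].
      by apply/measurable_EFinP; exact: (bf n).1.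
    by apply: cvg_EFin; [exact: nearW | exact: cf].
  exists K => x; have cfx : `|f_ n x| @[n --> \oo] --> `|f x| by apply: cvg_norm; exact: cf.
  rewrite -(cvg_lim _ cfx)//; apply: limr_le; first by apply/cvg_ex; eexists; exact: cfx.
  by apply: nearW => n; exact: fK.
have bk : bounded_measurable k by apply: lim_bounded ck => // n; case: (mk n).
have bk' : bounded_measurable k' by apply: lim_bounded ck' => // n; case: (mk n).
split => // h h' hh'; have [bh bh' _] := hh'.
split; try exact: bounded_measurableM.
move=> z z' zz'; have [mz mz'] := L_measurable zz'.
have lim_int (f g : T -> R) (l_ : nat -> T -> R) (l : T -> R) : bounded_measurable f ->
    bounded_measurable g -> (forall n, bounded_measurable (l_ n)) ->
    bounded_measurable l -> (forall n x, `|l_ n x| <= K) ->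
    (forall x, l_ n x @[n --> \oo] --> l x) ->
    \int[P]_x (f x * l_ n x * g x) @[n --> \oo] --> \int[P]_x (f x * l x * g x).
  move=> [mf [Mf fM]] [mg [Mg gM]] bl_ [ml _] lK cl.
  apply: (@bounded_convergence _ _ _ _ _ _ (Mf * K * Mg)).
  - move=> n; apply: measurable_funM => //; apply: measurable_funM => //.
    by case: (bl_ n).
  - by apply: measurable_funM => //; exact: measurable_funM.
  - by move=> n x; rewrite !normrM ler_pM// ?mulr_ge0// ler_pM.
  - by move=> x; apply: cvgMl => //; apply: cvgMr.
have mk1 n : bounded_measurable (k_ n) by case: (mk n).
have mk2 n : bounded_measurable (k'_ n) by case: (mk n).
have bcos := bounded_measurable_cos mz; have bcos' := bounded_measurable_cos mz'.
have bsin := bounded_measurable_sin mz; have bsin' := bounded_measurable_sin mz'.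
have eqn n : \int[P]_x (h x * k_ n x * cos (z x)) =
      \int[P]_x (h' x * k'_ n x * cos (z' x)) /\
    \int[P]_x (h x * k_ n x * sin (z x)) =
      \int[P]_x (h' x * k'_ n x * sin (z' x)).
  by have [_ _ /(_ _ _ hh')[_ _ /(_ _ _ zz')]] := mk n.
split.
- have := lim_int _ _ _ _ bh' bcos' mk2 bk' k'K ck'.
  under eq_fun do rewrite -(eqn _).1.
  by move/(cvg_unique _ (lim_int _ _ _ _ bh bcos mk1 bk kK ck)); exact.
- have := lim_int _ _ _ _ bh' bsin' mk2 bk' k'K ck'.
  under eq_fun do rewrite -(eqn _).2.
  by move/(cvg_unique _ (lim_int _ _ _ _ bh bsin mk1 bk kK ck)); exact.
Qed.

(** The sign is a pointwise limit of polynomials bounded by 1 on [[-1, 1]], and polynomials in a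
    multiplier are multipliers. *)
Lemma multiplier_sg k k' : multiplier k k' ->
  multiplier (fun x => Num.sg (k x)) (fun x => Num.sg (k' x)).
Proof.
wlog : k k' / (forall x, `|k x| <= 1) /\ (forall x, `|k' x| <= 1).
  move=> wlg mk; have [[_ [K kK]] [_ [K' kK']] _] := mk.
  (* Scaling by a positive constant brings both functions into [[-1, 1]] without changing signs; the
     summand 1 keeps [M] positive when the bounds vanish. *)
  pose M := (1 + `|K| + `|K'|)^-1.
  have M0 : 0 < M by rewrite invr_gt0 ltr_pwDl// ltr_pwDl.
  have sgM y : Num.sg (M * y) = Num.sg y by rewrite sgrM gtr0_sg ?mul1r.
  have := wlg _ _ _ (multiplierM (multiplier_cst M) mk).
  under eq_fun do rewrite sgM.
  under [X in multiplier _ X]eq_fun do rewrite sgM.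
  apply; split => x; rewrite normrM gtr0_norm// mulrC ler_pdivrMr ?mul1r.
  - rewrite (le_trans (kK x))// (le_trans (ler_norm _))// -addrA addrCA lerDl.
    by rewrite addr_ge0.
  - by rewrite ltr_pwDl// ltr_pwDl.
  - by rewrite (le_trans (kK' x))// (le_trans (ler_norm _))// lerDr addr_ge0.
  - by rewrite ltr_pwDl// ltr_pwDl.
move=> [k1 k'1] mk.
apply: (@multiplier_lim (fun n x => iter n (@sign_step R) (k x))
    (fun n x => iter n (@sign_step R) (k' x)) _ _ 1).
(* [sign_step] is written with sums, products and constants only, so the closure properties apply
   term by term. *)
- elim=> [//|n IH] /=; rewrite /sign_step.
  apply: multiplierD; apply: multiplierM => //; try exact: multiplier_cst.
  by apply: multiplierM => //; exact: multiplierM.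
- by move=> n x; exact: iter_sign_step_norm.
- by move=> n x; exact: iter_sign_step_norm.
- by move=> x; exact: cvg_iter_sign_step.
- by move=> x; exact: cvg_iter_sign_step.
Qed.

Lemma sgr_half_sum (y : R) :
  2^-1 * (Num.sg y * Num.sg y + Num.sg y) = (0 < y)%R%:R.
Proof.
have [y0|y0|<-] := ltgtP 0 y; last by rewrite sgr0 mulr0 addr0 mulr0.
- by rewrite gtr0_sg//=; field.
- by rewrite ltr0_sg//=; ring.
Qed.

Lemma multiplier_gt0_of_sg k k' :
  multiplier (fun x => Num.sg (k x)) (fun x => Num.sg (k' x)) ->
  multiplier (fun x => (0 < k x)%R%:R) (fun x => (0 < k' x)%R%:R).
Proof.
move=> mk; under eq_fun do rewrite -sgr_half_sum.
under [X in multiplier _ X]eq_fun do rewrite -sgr_half_sum.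
apply: multiplierM; first exact: multiplier_cst.
by apply: multiplierD => //; exact: multiplierM.
Qed.

(** A linear functional is unbounded, so [multiplier_gt0] does not apply to it; its sign is
    recovered from the bounded functions [sin (z / (n + 1))]. *)
Lemma multiplier_gt0_linear z z' : L z z' ->
  multiplier (fun x => (0 < z x)%R%:R) (fun x => (0 < z' x)%R%:R).
Proof.
move=> zz'; apply: multiplier_gt0_of_sg.
apply: (@multiplier_lim (fun n x => Num.sg (sin (n.+1%:R^-1 * z x)))
    (fun n x => Num.sg (sin (n.+1%:R^-1 * z' x))) _ _ 1).
- move=> n; apply: multiplier_sg; apply: multiplier_sin.
  have := L_lin n.+1%:R^-1 L0 zz'.
  by under eq_fun do rewrite add0r; under [X in L _ X]eq_fun do rewrite add0r.
- by move=> n x; rewrite normr_sg; case: eqP.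
- by move=> n x; rewrite normr_sg; case: eqP.
- by move=> x; exact: cvg_sg_sin_div.
- by move=> x; exact: cvg_sg_sin_div.
Qed.

Lemma multiplier_gt0 k k' : multiplier k k' ->
  multiplier (fun x => (0 < k x)%R%:R) (fun x => (0 < k' x)%R%:R).
Proof. by move=> mk; apply/multiplier_gt0_of_sg/multiplier_sg. Qed.

(** Fubini moves the integral over [s] outside the expectation, where the identities known for each
    [s] can be integrated. *)
Lemma multiplier_integral d2 (S : measurableType d2) (nu : probability S R)
    (k_ k'_ : T * S -> R) :
  bounded_measurable k_ -> bounded_measurable k'_ ->
  (forall s, multiplier (fun x => k_ (x, s)) (fun x => k'_ (x, s))) ->
  multiplier (fun x => \int[nu]_s k_ (x, s)) (fun x => \int[nu]_s k'_ (x, s)).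
Proof.
move=> bk bk' mk.
have section_bounded (f : T * S -> R) : bounded_measurable f ->
    forall x, bounded_measurable (fun s => f (x, s)).
  move=> [mf [K fK]] x; split; last by exists K => s; exact: fK.
  exact: (measurableT_comp mf (pair1_measurable x)).
have sectionint (f : T * S -> R) : bounded_measurable f ->
    forall x, nu.-integrable setT (fun s => (f (x, s))%:E).
  move=> bf x; exact: bounded_measurable_integrable (section_bounded _ bf x).
have intb (f : T * S -> R) : bounded_measurable f ->
    (P \x nu)%E.-integrable setT (EFin \o f).
  move=> bf; apply: measurable_bounded_integrable => //.
  - rewrite -setXTT [ltLHS]product_measure1E//= probability_setT.
    by rewrite [X in (_ * X)%E]probability_setT mule1 ltry.
  - exact: bf.1.
  - exact: bounded_measurable_bounded.
have bint (f : T * S -> R) : bounded_measurable f ->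
    bounded_measurable (fun x => \int[nu]_s f (x, s)).
  move=> bf; split.
    apply: measurableT_comp => //.
    exact: (measurable_fubini_F (intb _ bf)).
  have [mf [K fK]] := bf; exists K => x.
  rewrite -lee_fin EFin_normr_Rintegral//; last exact: sectionint.
  have mfx : measurable_fun setT (fun s => (f (x, s))%:E).
    by case/integrableP : (sectionint _ bf x).
  apply: (le_trans (le_abse_integral nu measurableT mfx)).
  apply: (@le_trans _ _ (K%:E * nu setT)%E).
    apply: (integral_le_bound K%:E) => //.
    - by rewrite lee_fin (le_trans _ (fK (x, point))).
    - by apply: aeW => s _; rewrite lee_fin.
  by rewrite [X in (_ * X)%E]probability_setT mule1.
have swap (f : T * S -> R) (g l : T -> R) : bounded_measurable f ->
    bounded_measurable g -> bounded_measurable l ->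
    ((\int[P]_x (g x * (\int[nu]_s f (x, s)) * l x))%:E =
     \int[nu]_s (\int[P]_x (g x * f (x, s) * l x))%:E)%E.
  move=> bf bg bl.
  pose F (p : T * S) := g p.1 * f p * l p.1.
  have comp1 (u : T -> R) : bounded_measurable u ->
      bounded_measurable (fun p : T * S => u p.1).
    by move=> [mu [K uK]]; split;
      [exact: measurableT_comp | exists K => p; exact: uK].
  have bF : bounded_measurable F.
    by do ?apply: bounded_measurableM => //; exact: comp1.
  rewrite /Rintegral fineK; last first.
    apply: integrable_fin_num => //.
    apply: (bounded_measurable_integrable P).
    by apply: bounded_measurableM => //; apply: bounded_measurableM => //; exact: bint.
  transitivity (\int[P]_x \int[nu]_s (EFin \o F) (x, s))%E.
    apply: eq_integral => x _.
    rewrite mulrAC (_ : (g x * l x * _)%R = \int[nu]_s (g x * l x * f (x, s))); last first.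
      by rewrite RintegralZl//; exact: sectionint.
    rewrite /Rintegral fineK; last first.
      apply: integrable_fin_num => //; apply: (bounded_measurable_integrable nu).
      apply: bounded_measurableM; first exact: bounded_measurable_cst.
      exact: section_bounded.
    by apply: eq_integral => s _; rewrite /F/= mulrAC.
  rewrite (Fubini (intb _ bF)); apply: eq_integral => s _.
  rewrite fineK//; apply: integrable_fin_num => //.
  apply: (bounded_measurable_integrable P).
  have [mF [K FK]] := bF; split; last by exists K => x; exact: (FK (x, s)).
  exact: (measurableT_comp mF (pair2_measurable s)).
split; try exact: bint.
move=> h h' hh'; have [bh bh' _] := hh'.
split; try by apply: bounded_measurableM => //; exact: bint.
move=> z z' zz'; have [mz mz'] := L_measurable zz'.
have bcos := bounded_measurable_cos mz; have bcos' := bounded_measurable_cos mz'.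
have bsin := bounded_measurable_sin mz; have bsin' := bounded_measurable_sin mz'.
have eqs s : \int[P]_x (h x * k_ (x, s) * cos (z x)) =
      \int[P]_x (h' x * k'_ (x, s) * cos (z' x)) /\
    \int[P]_x (h x * k_ (x, s) * sin (z x)) =
      \int[P]_x (h' x * k'_ (x, s) * sin (z' x)).
  by have [_ _ /(_ _ _ hh')[_ _ /(_ _ _ zz')]] := mk s.
split; apply: EFin_inj; rewrite !swap//; apply: eq_integral => s _.
- by rewrite (eqs s).1.
- by rewrite (eqs s).2.
Qed.

End Multipliers.

(** * Lebesgue measure on tuples *)

(* Unification cannot find the measurability proof of f that the canonical
   measure structure of a pushforward depends on. *)
Definition pushforward_measure d d' (T1 : measurableType d)
    (T2 : measurableType d') (R : realFieldType)
    (m : {measure set T1 -> \bar R}) (f : T1 -> T2)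
    (mf : measurable_fun setT f) : {measure set T2 -> \bar R} :=
  measure_function_pushforward__canonical__measure_function_Measure m mf.

Section LebesgueTranslation.
Variable R : realType.
Notation mu := (@lebesgue_measure R).

Lemma measurable_addl (a : R) : measurable_fun setT (fun x : R => x + a).
Proof. exact: measurable_funD. Qed.

Lemma lebesgue_measure_translate (a : R) (A : set R) : measurable A ->
  mu ((fun x => x + a) @^-1` A) = mu A.
Proof.
move=> mA; apply/esym.
have mf : measurable_fun [set: measurableTypeR R]
    ((fun x => x + a) : measurableTypeR R -> measurableTypeR R).
  exact: measurable_addl.
pose nu : {measure set (measurableTypeR R) -> \bar R} :=
  pushforward_measure mu mf.
apply: (@lebesgue_measure_unique _ nu) => // X [[x y] _ <-].
rewrite /nu/= /pushforward.
rewrite (_ : _ @^-1` _ = `]x - a, y - a]%classic); last first.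
  apply/seteqP; split => u /=; rewrite !in_itv/=; lra.
rewrite !lebesgue_measure_itv/= !lte_fin ltrD2r.
by case: ifP => // _; rewrite -!EFinD; congr EFin; ring.
Qed.

Lemma ge0_integral_translate (a : R) (f : R -> \bar R) :
  measurable_fun setT f -> (forall x, (0 <= f x)%E) ->
  (\int[mu]_x f ((x : R) + a)%R)%E = (\int[mu]_x f x)%E.
Proof.
move=> mf f0; pose tr : measurableTypeR R -> measurableTypeR R := fun x : R => x + a.
have mtr : measurable_fun setT tr := measurable_addl a.
transitivity (\int[pushforward mu tr]_x f x)%E.
  by rewrite ge0_integral_pushforward.
apply: eq_measure_integral => A mA _.
exact: lebesgue_measure_translate.
Qed.

End LebesgueTranslation.

Section ConsMeasure.
Context (R : realType) (n : nat).
Variable m : {sigma_finite_measure set (n.-tuple R) -> \bar R}.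

Definition pair_cons (p : R * n.-tuple R) : n.+1.-tuple R := cons_tuple p.1 p.2.

Lemma measurable_pair_cons : measurable_fun setT pair_cons.
Proof.
apply/measurable_fun_tnthP => i.
have [j ->|->] := unliftP ord0 i.
  rewrite (_ : _ \o _ = (fun p : R * n.-tuple R => tnth p.2 j)).
    exact: (measurableT_comp (measurable_tnth j)).
  by apply/funext => p /=; rewrite tnthS.
rewrite (_ : _ \o _ = (fun p : R * n.-tuple R => p.1)).
  exact: measurable_fst.
by apply/funext => p /=; rewrite tnth0.
Qed.

(** The inductive step of [lebesgue_tuple] seen as a product measure carried to tuples; this form
    brings countable additivity with it. *)
Definition cons_measure : set (n.+1.-tuple R) -> \bar R :=
  pushforward (@lebesgue_measure R \x m)%E pair_cons.

Let cons_measure0 : cons_measure set0 = 0%E.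
Proof. by rewrite /cons_measure /pushforward preimage_set0 measure0. Qed.

Let cons_measure_ge0 A : (0 <= cons_measure A)%E.
Proof. by apply: integral_ge0. Qed.

Let cons_measure_additive : semi_sigma_additive cons_measure.
Proof.
exact: (@measure_semi_sigma_additive _ _ _
  (pushforward_measure (@lebesgue_measure R \x m)%E measurable_pair_cons)).
Qed.

HB.instance Definition _ := isMeasure.Build _ _ _ cons_measure
  cons_measure0 cons_measure_ge0 cons_measure_additive.

Let cons_measure_sigma_finite : sigma_finite setT cons_measure.
Proof.
have /sigma_finiteP[F [FT ndF Foo]] := sigma_finiteT (@lebesgue_measure R).
have /sigma_finiteP[G [GT ndG Goo]] := sigma_finiteT m.
pose uncons (t : n.+1.-tuple R) := (tnth t ord0, [tuple of behead t]).
have muncons : measurable_fun setT uncons.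
  apply/measurable_fun_pairP; split.
    exact: measurable_tnth.
  exact: measurable_behead.
exists (fun i => uncons @^-1` (F i `*` G i)).
  rewrite -preimage_bigcup; apply/seteqP; split => // t _.
  have [i _ Fi] : (\bigcup_i F i) (uncons t).1 by rewrite -FT.
  have [j _ Gj] : (\bigcup_j G j) (uncons t).2 by rewrite -GT.
  (* Both exhausting sequences are nondecreasing, so the larger index serves for the head and for
     the tail. *)
  exists (maxn i j) => //; split.
    by apply: (subsetPset _ _ (ndF _ _ (leq_maxl i j))).
  by apply: (subsetPset _ _ (ndG _ _ (leq_maxr i j))).
move=> i; have [mF Fi] := Foo i; have [mG Gi] := Goo i.
have mFG : measurable (F i `*` G i) by exact: measurableX.
split; first by rewrite -[X in measurable X]setTI; exact: muncons.
rewrite /cons_measure /pushforward -comp_preimage.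
rewrite (_ : uncons \o pair_cons = id); last first.
  by apply/funext => -[x t]; congr pair; apply/val_inj.
by rewrite preimage_id product_measure1E// lte_mul_pinfty// ge0_fin_numE.
Qed.

HB.instance Definition _ := @Measure_isSigmaFinite.Build _ _ _ cons_measure
  cons_measure_sigma_finite.

End ConsMeasure.

Section LebesgueTuple.
Variable R : realType.
Notation mu := (@lebesgue_measure R).

(** An actual measure [m] is carried through the induction: forming the product in dimension [n + 1]
    requires a sigma-finite measure in dimension [n], not a bare set function. *)
Lemma lebesgue_tuple_sigma_finite_measure n :
  exists m : {sigma_finite_measure set (n.-tuple R) -> \bar R},
    forall A, measurable A -> lebesgue_tuple A = m A.
Proof.
elim: n => [|n [m mE]].
  by exists (dirac [tuple] : {sigma_finite_measure set _ -> \bar R}).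
exists (cons_measure m : {sigma_finite_measure set _ -> \bar R}) => A mA /=.
apply: eq_integral => x _ /=.
rewrite mE; first by congr (m _); apply/seteqP; split => t; rewrite /xsection/= inE.
have := measurable_xsection x (measurable_pair_cons measurableT mA).
by rewrite setTI; congr measurable; apply/seteqP; split => t; rewrite /xsection/= inE.
Qed.

Section Instance.
Variable n : nat.

Let lebesgue_tuple0 : @lebesgue_tuple R n set0 = 0%E.
Proof. by have [m ->] := lebesgue_tuple_sigma_finite_measure n. Qed.

Lemma lebesgue_tuple_ge0 A : (0 <= @lebesgue_tuple R n A)%E.
Proof.
elim: n A => [|k IH] A /=; first by rewrite lee_fin.
by apply: integral_ge0 => x _; exact: IH.
Qed.

Let lebesgue_tuple_additive : semi_sigma_additive (@lebesgue_tuple R n).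
Proof.
have [m mE] := lebesgue_tuple_sigma_finite_measure n.
move=> F mF tF mUF; rewrite mE//; under eq_fun do under eq_bigr do rewrite mE//.
exact: measure_semi_sigma_additive.
Qed.

HB.instance Definition _ := isMeasure.Build _ _ _ (@lebesgue_tuple R n)
  lebesgue_tuple0 lebesgue_tuple_ge0 lebesgue_tuple_additive.

Let lebesgue_tuple_sigma_finite : sigma_finite setT (@lebesgue_tuple R n).
Proof.
have [m mE] := lebesgue_tuple_sigma_finite_measure n.
have [F FT Foo] := sigma_finiteT m; exists F => // i.
by have [mF ?] := Foo i; split; rewrite // mE.
Qed.

HB.instance Definition _ := @Measure_isSigmaFinite.Build _ _ _
  (@lebesgue_tuple R n) lebesgue_tuple_sigma_finite.

End Instance.

Lemma measurable_fun_lebesgue_section n (A : set (n.+1.-tuple R)) :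
  measurable A ->
  measurable_fun setT (fun x : R => lebesgue_tuple [set t | A (cons_tuple x t)]).
Proof.
move=> mA; have mA' := measurable_pair_cons measurableT mA.
rewrite setTI in mA'.
have := measurable_fun_xsection (@lebesgue_tuple R n) mA'.
apply: eq_measurable_fun => x _ /=.
by congr lebesgue_tuple; apply/seteqP; split => t; rewrite /xsection/= inE.
Qed.

Definition addt n (x y : n.-tuple R) : n.-tuple R :=
  [tuple tnth x i + tnth y i | i < n].

Lemma tnth_addt n (x y : n.-tuple R) i : tnth (addt x y) i = tnth x i + tnth y i.
Proof. by rewrite tnth_mktuple. Qed.

Lemma addt_cons n (x : R) (t : n.-tuple R) (v : n.+1.-tuple R) :
  addt (cons_tuple x t) v =
  cons_tuple (x + tnth v ord0) (addt t [tuple of behead v]).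
Proof.
apply: eq_from_tnth => i; rewrite tnth_addt; case: (unliftP ord0 i) => [j|] ->.
  by rewrite !tnthS tnth_addt; congr (_ + _); rewrite [in LHS](tuple_eta v) tnthS.
by rewrite !tnth0.
Qed.

Lemma measurable_set_tuple n (A : set (n.-tuple R)) : measurable A ->
  forall d (T : measurableType d) (f : T -> n.-tuple R),
  (forall i, measurable_fun setT (fun x => tnth (f x) i)) ->
  measurable (f @^-1` A).
Proof.
move=> mA d T f mf; rewrite -[X in measurable X]setTI.
have : measurable_fun setT f by apply/measurable_fun_tnthP.
by apply.
Qed.

Lemma lebesgue_tuple_translate n (v : n.-tuple R) (A : set (n.-tuple R)) :
  measurable A -> lebesgue_tuple ((fun x => addt x v) @^-1` A) = lebesgue_tuple A.
Proof.
elim: n v A => [|n IH] v A mA.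
  have tv t : addt t v = t by apply: eq_from_tnth => -[].
  by congr lebesgue_tuple; apply/seteqP; split => t /=; rewrite tv.
pose F (x : R) := lebesgue_tuple [set t | A (cons_tuple x t)].
have mF : measurable_fun setT F := measurable_fun_lebesgue_section mA.
rewrite /= -(@ge0_integral_translate _ (tnth v ord0) F)//.
apply: eq_integral => x _; rewrite /F.
rewrite -[RHS](IH [tuple of behead v]).
  by congr lebesgue_tuple; apply/seteqP; split => t /=; rewrite addt_cons.
apply: (measurable_set_tuple mA) => i.
case: (unliftP ord0 i) => [j|] ->.
  under eq_fun do rewrite tnthS; exact: measurable_tnth.
by under eq_fun do rewrite tnth0; exact: measurable_cst.
Qed.

(** Cubes serve to enclose the punctured ball and to be enclosed in it, which bounds its volume on
    both sides. *)
Lemma lebesgue_tuple_cube n (I : set R) : measurable I ->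
  lebesgue_tuple [set t : n.-tuple R | forall i, I (tnth t i)] = (mu I ^+ n)%E.
Proof.
move=> mI; elim: n => [|n IH].
  rewrite /= indicE mem_set//= => i; by case: i.
rewrite expeS /=; transitivity (\int[mu]_x ((\1_I x)%:E * mu I ^+ n))%E; last first.
  rewrite ge0_integralZr//; last exact: expe_ge0.
    by rewrite integral_indic// setIT.
  exact/measurable_EFinP.
apply: eq_integral => x _; rewrite indicE; case: (boolP (x \in I)) => [|] xI.
  rewrite mul1e -IH; congr lebesgue_tuple; apply/seteqP; split => t /=.
    by move=> h i; have := h (lift ord0 i); rewrite tnthS.
  move=> h i; case: (unliftP ord0 i) => [j|] ->; rewrite ?tnthS ?tnth0//.
  exact: set_mem.
rewrite mul0e (_ : [set t | _] = set0) ?measure0//.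
rewrite -subset0 => t /= /(_ ord0); rewrite tnth0 => /mem_set.
by rewrite (negbTE xI).
Qed.

Lemma measurable_tuple_set1 n (v : n.-tuple R) : measurable [set v].
Proof.
rewrite (_ : [set v] = \bigcap_(i in [set: 'I_n])
    ((fun t : n.-tuple R => tnth t i) @^-1` [set tnth v i])).
  apply: fin_bigcap_measurable => // i _; rewrite -[X in measurable X]setTI.
  exact: measurable_tnth.
apply/seteqP; split => [t -> i //|t h]; apply: eq_from_tnth => i; exact: h.
Qed.

Lemma lebesgue_tuple_set1 n (v : n.+1.-tuple R) : lebesgue_tuple [set v] = 0%E.
Proof.
have mv := measurable_tuple_set1 v.
rewrite /= (@ge0_negligible_integral _ _ _ mu setT [set tnth v ord0])//; last 2 first.
- exact: (measurable_fun_lebesgue_section mv).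
- exact: lebesgue_measure_set1.
apply: integral0_eq => x [_ /= xv]; rewrite (_ : [set t | _] = set0) ?measure0//.
by rewrite -subset0 => t /= vE; apply: xv; rewrite -vE tnth0.
Qed.

End LebesgueTuple.

Lemma integral_section_swap d1 d2 (T1 : measurableType d1) (T2 : measurableType d2)
    (R : realType) (m1 : {sigma_finite_measure set T1 -> \bar R})
    (m2 : {sigma_finite_measure set T2 -> \bar R}) (E : set (T1 * T2)) :
  measurable E ->
  (\int[m1]_x m2 (xsection E x) = \int[m2]_y m1 (ysection E y))%E.
Proof.
move=> mE; have := indic_fubini_tonelli m1 m2 mE.
rewrite (_ : (\int[m2]_y _)%E = (\int[m2]_y m1 (ysection E y))%E); last first.
  by apply: eq_integral => y _; exact: (congr1 (@^~ y) (indic_fubini_tonelli_GE m1 mE)).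
by move=> <-; apply: eq_integral => x _; exact/esym/(congr1 (@^~ x) (indic_fubini_tonelli_FE m2 mE)).
Qed.

(** * Inner product on tuples and uniqueness of translation invariant measures *)

Section TupleGeometry.
Context {R : realType}.
Implicit Type n : nat.

Definition scalet n (c : R) (x : n.-tuple R) : n.-tuple R :=
  map_tuple (fun y => c * y) x.

Lemma tnth_scalet n c (x : n.-tuple R) i : tnth (scalet c x) i = c * tnth x i.
Proof. by rewrite tnth_map. Qed.

Lemma dotRC n (x y : n.-tuple R) : dotR x y = dotR y x.
Proof. by apply: eq_bigr => i _; rewrite mulrC. Qed.

Lemma dotRDl n (x y z : n.-tuple R) : dotR (addt x y) z = dotR x z + dotR y z.
Proof. by rewrite -big_split; apply: eq_bigr => i _; rewrite tnth_addt mulrDl. Qed.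

Lemma dotRZl n c (x z : n.-tuple R) : dotR (scalet c x) z = c * dotR x z.
Proof.
by rewrite mulr_sumr; apply: eq_bigr => i _; rewrite tnth_scalet mulrA.
Qed.

Lemma dotRDr n (x y z : n.-tuple R) : dotR z (addt x y) = dotR z x + dotR z y.
Proof. by rewrite dotRC dotRDl !(dotRC z). Qed.

Lemma dotRZr n c (x z : n.-tuple R) : dotR z (scalet c x) = c * dotR z x.
Proof. by rewrite dotRC dotRZl (dotRC z). Qed.

Lemma dotR_ge0 n (x : n.-tuple R) : 0 <= dotR x x.
Proof. by apply: sumr_ge0 => i _; exact: sqr_ge0. Qed.

Lemma dotR_eq0 n (x : n.-tuple R) : dotR x x = 0 -> forall i, tnth x i = 0.
Proof.
move=> /eqP; rewrite psumr_eq0 => [/allP h i|i _]; last exact: sqr_ge0.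
by have := h i (mem_index_enum i); rewrite mulf_eq0 orbb => /eqP.
Qed.

Lemma measurable_dotR n d (T : measurableType d) (f g : T -> n.-tuple R) :
  measurable_fun setT f -> measurable_fun setT g ->
  measurable_fun setT (fun x => dotR (f x) (g x)).
Proof.
move=> mf mg; apply: measurable_sum => i; apply: measurable_funM.
  exact: (measurableT_comp (measurable_tnth i)).
exact: (measurableT_comp (measurable_tnth i)).
Qed.

Lemma measurable_addt n d (T : measurableType d) (f g : T -> n.-tuple R) :
  measurable_fun setT f -> measurable_fun setT g ->
  measurable_fun setT (fun x => addt (f x) (g x)).
Proof.
move=> mf mg; apply/measurable_fun_tnthP => i.
rewrite (_ : _ \o _ = (fun x => tnth (f x) i + tnth (g x) i)); last first.
  by apply/funext => x /=; rewrite tnth_addt.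
apply: measurable_funD; exact: (measurableT_comp (measurable_tnth i)).
Qed.

Lemma measurable_scalet n d (T : measurableType d) (c : T -> R)
    (f : T -> n.-tuple R) :
  measurable_fun setT c -> measurable_fun setT f ->
  measurable_fun setT (fun x => scalet (c x) (f x)).
Proof.
move=> mc mf; apply/measurable_fun_tnthP => i.
rewrite (_ : _ \o _ = (fun x => c x * tnth (f x) i)); last first.
  by apply/funext => x /=; rewrite tnth_scalet.
apply: measurable_funM => //; exact: (measurableT_comp (measurable_tnth i)).
Qed.

(* The integral of 1_A(x + y) 1_B(y) is evaluated in both orders of
   integration, which shows that a translation invariant measure is determined
   up to a constant. *)
Lemma translation_invariant_proportional n
    (m1 m2 : {sigma_finite_measure set (n.-tuple R) -> \bar R})
    (A B : set (n.-tuple R)) :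
  (forall v C, measurable C -> m1 ((fun x => addt x v) @^-1` C) = m1 C) ->
  (forall v C, measurable C -> m2 ((fun x => addt x v) @^-1` C) = m2 C) ->
  measurable A -> measurable B -> (forall x, B (scalet (-1) x) <-> B x) ->
  (m1 A * m2 B = m2 A * m1 B)%E.
Proof.
move=> inv1 inv2 mA mB symB.
pose E1 := [set p : n.-tuple R * n.-tuple R | A (addt p.1 p.2) /\ B p.2].
pose E2 := [set p : n.-tuple R * n.-tuple R |
  A p.2 /\ B (addt p.2 (scalet (-1) p.1))].
have preim_measurable d (T : measurableType d) (f : T -> n.-tuple R) C :
    measurable C -> measurable_fun setT f -> measurable [set x | C (f x)].
  by move=> mC mf; rewrite -[X in measurable X]setTI; exact: mf.
have mE1 : measurable E1.
  apply: measurableI; apply: preim_measurable => //.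
  exact: measurable_addt.
have mE2 : measurable E2.
  apply: measurableI; apply: preim_measurable => //.
  by apply: measurable_addt => //; exact: measurable_scalet.
(* For fixed [x], the translation of [y] by [x] carries one section to the other. *)
have E12 x : m2 (xsection E1 x) = m2 (xsection E2 x).
  rewrite -(inv2 x (xsection E2 x)); last exact: measurable_xsection.
  congr (m2 _); apply/seteqP; split => y; rewrite /xsection/= !inE /E1 /E2/=.
    have -> : addt (addt y x) (scalet (-1) x) = y.
      by apply: eq_from_tnth => i; rewrite !(tnth_addt, tnth_scalet); ring.
    have -> : addt y x = addt x y.
      by apply: eq_from_tnth => i; rewrite !tnth_addt addrC.
    by [].
  have -> : addt (addt y x) (scalet (-1) x) = y.
    by apply: eq_from_tnth => i; rewrite !(tnth_addt, tnth_scalet); ring.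
  have -> : addt y x = addt x y.
    by apply: eq_from_tnth => i; rewrite !tnth_addt addrC.
  by [].
have lhs : (\int[m2]_y m1 (ysection E1 y) = m1 A * m2 B)%E.
  transitivity (\int[m2]_y (m1 A * (\1_B y)%:E))%E; last first.
    by rewrite ge0_integralZl//= ?integral_indic ?setIT//; exact/measurable_EFinP.
  apply: eq_integral => y _; rewrite indicE; case: (boolP (y \in B)) => yB.
    rewrite mule1 -[RHS](inv1 y)//; congr (m1 _); apply/seteqP.
    by split => x; rewrite /ysection/= inE /E1/= ; [case|move=> h; split => //; exact: set_mem].
  rewrite mule0 (_ : ysection _ _ = set0) ?measure0// -subset0 => x.
  by rewrite /ysection/= inE => -[_ /mem_set]; rewrite (negbTE yB).
have rhs : (\int[m2]_y m1 (ysection E2 y) = m2 A * m1 B)%E.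
  transitivity (\int[m2]_y ((\1_A y)%:E * m1 B))%E; last first.
    by rewrite ge0_integralZr//= ?integral_indic ?setIT//; exact/measurable_EFinP.
  apply: eq_integral => y _; rewrite indicE; case: (boolP (y \in A)) => yA.
    rewrite mul1e -[RHS](inv1 (scalet (-1) y))//; congr (m1 _); apply/seteqP.
    (* The symmetry of [B] turns [y - x] into [x - y], so the section in [x] is a translate of [B]
       and invariance of [m1] under negation is not called for. *)
    have Bsym x : B (addt y (scalet (-1) x)) <-> B (addt x (scalet (-1) y)).
      rewrite -symB; set u := scalet (-1) _; set v := addt x _.
      suff -> : u = v by [].
      by apply: eq_from_tnth => i; rewrite !(tnth_addt, tnth_scalet); ring.
    by split => x; rewrite /ysection/= inE /E2/=;
      [move=> [_ /Bsym]|move=> /Bsym h; split => //; exact: set_mem].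
  rewrite mul0e (_ : ysection _ _ = set0) ?measure0// -subset0 => x.
  by rewrite /ysection/= inE => -[/mem_set]; rewrite (negbTE yA).
rewrite -lhs -rhs -(integral_section_swap _ _ mE1) -(integral_section_swap _ _ mE2).
by apply: eq_integral => x _; exact: E12.
Qed.

End TupleGeometry.

(** * Orthogonal reflections and their action on Lebesgue measure *)

Section Reflection.
Context {R : realType} {n : nat}.
Implicit Types u x y : n.-tuple R.

(** The Householder reflection in the hyperplane orthogonal to [u]. For [u = 0] the convention
    [0^-1 = 0] makes it the identity, so the identities below hold for every [u]. *)
Definition reflect u x : n.-tuple R :=
  addt x (scalet (- (2 * dotR u x / dotR u u)) u).

Lemma measurable_reflect u : measurable_fun setT (reflect u).
Proof.
apply: measurable_addt => //; apply: measurable_scalet => //.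
apply: measurableT_comp => //; apply: measurable_funM => //.
by apply: measurable_funM => //; exact: measurable_dotR.
Qed.

Lemma dotR_reflect u x y : dotR (reflect u x) (reflect u y) = dotR x y.
Proof.
rewrite /reflect !(dotRDl, dotRDr, dotRZl, dotRZr) (dotRC x u).
have [->|u0] := eqVneq (dotR u u) 0; first by rewrite !invr0; ring.
by field.
Qed.

Lemma reflectK u x : reflect u (reflect u x) = x.
Proof.
apply: eq_from_tnth => i; rewrite !(tnth_addt, tnth_scalet) dotRDr dotRZr.
have [->|u0] := eqVneq (dotR u u) 0; first by rewrite !invr0; ring.
by field.
Qed.

Lemma reflectD u x y : reflect u (addt x y) = addt (reflect u x) (reflect u y).
Proof.
by apply: eq_from_tnth => i; rewrite !(tnth_addt, tnth_scalet) dotRDr; ring.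
Qed.

Lemma reflectZ u c x : reflect u (scalet c x) = scalet c (reflect u x).
Proof.
by apply: eq_from_tnth => i; rewrite !(tnth_addt, tnth_scalet) dotRZr; ring.
Qed.

(** For unit vectors and [u = x - y] one has [|u|^2 = 2 <u, x>]; the coefficient of [u] is then 1
    and [x - u = y]. The case [x = y] is the degenerate reflection. *)
Lemma reflect_swap x y : dotR x x = 1 -> dotR y y = 1 ->
  reflect (addt x (scalet (-1) y)) x = y.
Proof.
move=> x1 y1; set u := addt x _.
have uu : dotR u u = 2 * dotR u x.
  by rewrite !(dotRDl, dotRDr, dotRZl, dotRZr) x1 y1 (dotRC y x); ring.
have [u0|u0] := eqVneq (dotR u u) 0; apply: eq_from_tnth => i.
  have := dotR_eq0 u0 i; rewrite !(tnth_addt, tnth_scalet) => xy.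
  by rewrite u0 invr0; lra.
by rewrite /reflect -uu mulfV// !(tnth_addt, tnth_scalet); ring.
Qed.

End Reflection.

Section ReflectedLebesgue.
Context {R : realType} {n : nat}.
Variable u : n.-tuple R.
Notation lambda := (@lebesgue_tuple R n).

Definition reflected_lebesgue : set (n.-tuple R) -> \bar R :=
  pushforward lambda (reflect u).

Let reflected0 : reflected_lebesgue set0 = 0%E.
Proof. by rewrite /reflected_lebesgue /pushforward preimage_set0 measure0. Qed.

Let reflected_ge0 A : (0 <= reflected_lebesgue A)%E.
Proof. exact: lebesgue_tuple_ge0. Qed.

Let reflected_additive : semi_sigma_additive reflected_lebesgue.
Proof.
exact: (@measure_semi_sigma_additive _ _ _
  (pushforward_measure lambda (measurable_reflect u))).
Qed.

HB.instance Definition _ := isMeasure.Build _ _ _ reflected_lebesgue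
  reflected0 reflected_ge0 reflected_additive.

Let reflected_sigma_finite : sigma_finite setT reflected_lebesgue.
Proof.
have [F FT Foo] := sigma_finiteT lambda.
exists (fun i => reflect u @^-1` F i).
  by rewrite -preimage_bigcup -FT preimage_setT.
move=> i; have [mF Fi] := Foo i; split.
  by rewrite -[X in measurable X]setTI; exact: measurable_reflect.
rewrite /reflected_lebesgue /pushforward -comp_preimage (_ : _ \o _ = id)//.
by apply/funext => x /=; rewrite reflectK.
Qed.

HB.instance Definition _ := @Measure_isSigmaFinite.Build _ _ _
  reflected_lebesgue reflected_sigma_finite.

End ReflectedLebesgue.

Section PuncturedBall.
Context {R : realType} {k : nat}.
Notation n := k.+1.
Notation lambda := (@lebesgue_tuple R n).

(** This is the cone over the whole sphere: radii in [cone] are positive, so the origin is left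
    out. *)
Definition punctured_ball : set (n.-tuple R) := [set x | 0 < dotR x x <= 1].

Lemma measurable_punctured_ball : measurable punctured_ball.
Proof.
rewrite (_ : punctured_ball = (fun x => dotR x x) @^-1` `]0, 1]%classic).
  by rewrite -[X in measurable X]setTI; exact: measurable_dotR.
by apply/seteqP; split => x /=; rewrite in_itv.
Qed.

Lemma measurable_cube (I : set R) : measurable I ->
  measurable [set t : n.-tuple R | forall i, I (tnth t i)].
Proof.
move=> mI; rewrite (_ : [set t | _] = \bigcap_(i in [set: 'I_n])
    ((fun t : n.-tuple R => tnth t i) @^-1` I)).
  apply: fin_bigcap_measurable => // i _; rewrite -[X in measurable X]setTI.
  exact: measurable_tnth.
by apply/seteqP; split => [t h i _|t h i]; exact: h.
Qed.

Lemma lebesgue_punctured_ball_lty : (lambda punctured_ball < +oo)%E.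
Proof.
apply: (@le_lt_trans _ _
    (lambda [set t | forall i, `[(-1)%R, 1%R]%classic (tnth t i)])).
  apply: le_measure; rewrite ?inE//.
  - exact: measurable_punctured_ball.
  - exact: measurable_cube.
  move=> x /= /andP[_ x1] i; rewrite in_itv/= -ler_norml.
  rewrite -(@expr_le1 _ 2)// real_normK ?num_real//.
  apply: le_trans x1; rewrite /dotR (bigD1 i)//= lerDl.
  by apply: sumr_ge0 => j _; exact: sqr_ge0.
rewrite lebesgue_tuple_cube// lebesgue_measure_itv ifT; last first.
  by rewrite lte_fin; lra.
by rewrite -EFinB -EFin_expe ltry.
Qed.

Lemma lebesgue_punctured_ball_gt0 : (0 < lambda punctured_ball)%E.
Proof.
(* On []0, c]^n] each square is at most [c], so the squared norm is at most [n * c = 1]; positive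
   coordinates avoid the origin. *)
pose c : R := n%:R^-1.
have c0 : 0 < c by rewrite invr_gt0.
have c1 : c <= 1 by rewrite invf_le1// ler1n.
apply: (@lt_le_trans _ _
    (lambda [set t | forall i, `]0%R, c]%classic (tnth t i)])).
  rewrite lebesgue_tuple_cube// lebesgue_measure_itv ifT ?lte_fin//.
  by rewrite -EFinB subr0 -EFin_expe lte_fin exprn_gt0.
apply: le_measure; rewrite ?inE//.
- exact: measurable_cube.
- exact: measurable_punctured_ball.
move=> x /= xc; apply/andP; split.
  rewrite lt_neqAle dotR_ge0 andbT eq_sym; apply/eqP => /dotR_eq0/(_ ord0) x0.
  by have := xc ord0; rewrite x0 in_itv/= ltxx.
apply: (@le_trans _ _ (\sum_(i < n) c * 1)).
  apply: ler_sum => i _; have := xc i; rewrite in_itv/= => /andP[xi0 xi1].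
  by apply: ler_pM => //; [exact: ltW|exact: ltW|exact: le_trans c1].
by rewrite sumr_const card_ord mulr1 -mulr_natr mulVf.
Qed.

(** The reflected measure is translation invariant, hence proportional to [lambda]; the punctured
    ball is mapped to itself and has finite positive volume, so the ratio is 1. *)
Lemma lebesgue_tuple_reflect (u : n.-tuple R) A : measurable A ->
  lambda (reflect u @^-1` A) = lambda A.
Proof.
move=> mA; have mg := measurable_reflect u.
have gpre (C : set (n.-tuple R)) : measurable C -> measurable (reflect u @^-1` C).
  by move=> mC; rewrite -[X in measurable X]setTI; exact: mg.
pose M2 := [the {sigma_finite_measure set _ -> \bar R} of reflected_lebesgue u].
have M2B : M2 punctured_ball = lambda punctured_ball.
  by congr lambda; apply/seteqP; split => x; rewrite /punctured_ball/= dotR_reflect.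
have prop : (lambda A * M2 punctured_ball = M2 A * lambda punctured_ball)%E.
  apply: translation_invariant_proportional => //.
  - by move=> v C mC; exact: lebesgue_tuple_translate.
  (* By linearity, translating by [v] after reflecting amounts to translating by [reflect u v]
     before. *)
  - move=> v C mC; rewrite /M2/= /reflected_lebesgue /pushforward.
    rewrite -(lebesgue_tuple_translate (reflect u v) (gpre _ mC)).
    congr lambda; apply/seteqP; split => x /=; rewrite reflectD reflectK//.
  - exact: measurable_punctured_ball.
  - move=> x; rewrite /punctured_ball/= dotRZl dotRZr.
    by rewrite (_ : -1 * (-1 * dotR x x) = dotR x x)//; ring.
move: prop; rewrite M2B.
have p0 : (0 < fine (lambda punctured_ball))%R.
  by rewrite fine_gt0// lebesgue_punctured_ball_gt0 lebesgue_punctured_ball_lty.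
have /fineK <- : lambda punctured_ball \is a fin_num.
  by rewrite ge0_fin_numE// lebesgue_punctured_ball_lty.
move=> /(congr1 (fun x => x * (fine (lambda punctured_ball))^-1%:E))%E.
by rewrite -!muleA -EFinM mulfV ?gt_eqF// !mule1.
Qed.

End PuncturedBall.

(** * Normalised surface measure *)

Section ConeProbability.
Context {R : realType} {k : nat}.
Notation n := k.+1.
Notation lambda := (@lebesgue_tuple R n).
Notation ball := (@punctured_ball R k).
Implicit Types A : set (n.-tuple R).

Definition normalize (x : n.-tuple R) : n.-tuple R :=
  scalet (Num.sqrt (dotR x x))^-1 x.

Lemma measurable_normalize : measurable_fun setT normalize.
Proof.
apply: measurable_scalet => //.
rewrite (_ : (fun _ => _) = (fun x : n.-tuple R => powR (dotR x x) (- 2^-1))).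
  exact: (measurableT_comp (measurable_powR _) (measurable_dotR _ _)).
by apply/funext => x; rewrite powRN powR12_sqrt// dotR_ge0.
Qed.

Lemma dotR_normalize x : 0 < dotR x x -> dotR (normalize x) (normalize x) = 1.
Proof.
move=> x0; rewrite dotRZl dotRZr mulrA -expr2 exprVn sqr_sqrtr ?dotR_ge0//.
by rewrite mulVf// gt_eqF.
Qed.

Lemma measurable_sphere : measurable (@sphere R n).
Proof.
rewrite (_ : sphere n = (fun x => dotR x x) @^-1` [set 1]) //.
by rewrite -[X in measurable X]setTI; exact: measurable_dotR.
Qed.

(** Polar coordinates: the radius is the norm and the direction is [normalize x]. The preimage form
    gives measurability of the cone. *)
Lemma coneE A : A `<=` @sphere R n ->
  cone A = ball `&` normalize @^-1` A.
Proof.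
move=> As; apply/seteqP; split => x /=.
  move=> [r [/andP[r0 r1] [s sA ->]]].
  rewrite -/(scalet r s) /punctured_ball/= dotRZl dotRZr (As _ sA) mulr1.
  split; first by apply/andP; split; nra.
  rewrite /normalize dotRZl dotRZr (As _ sA) mulr1 -expr2 sqrtr_sqr gtr0_norm//.
  rewrite (_ : scalet _ _ = s)//; apply: eq_from_tnth => i.
  by rewrite !tnth_scalet mulrA mulVf ?mul1r ?gt_eqF.
move=> [/andP[x0 x1] nA].
exists (Num.sqrt (dotR x x)); split.
  by rewrite sqrtr_gt0 x0/= -[leRHS]sqrtr1 ler_wsqrtr.
exists (normalize x) => //; apply: eq_from_tnth => i.
by rewrite tnth_map tnth_scalet mulrA mulfV ?mul1r// gt_eqF// sqrtr_gt0.
Qed.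

Lemma lebesgue_ball_fin_num : lambda ball \is a fin_num.
Proof. by rewrite ge0_fin_numE ?lebesgue_punctured_ball_lty ?lebesgue_tuple_ge0. Qed.

Lemma fine_lebesgue_ball_gt0 : 0 < fine (lambda ball).
Proof. by rewrite fine_gt0// lebesgue_punctured_ball_gt0 lebesgue_punctured_ball_lty. Qed.

(* The law of x / |x| for x uniform in the punctured unit ball. *)
Definition cone_prob A : \bar R :=
  (lambda (ball `&` normalize @^-1` A) * (fine (lambda ball))^-1%:E)%E.

Let preim_measurable A : measurable A -> measurable (normalize @^-1` A).
Proof. by move=> mA; rewrite -[X in measurable X]setTI; exact: measurable_normalize. Qed.

Lemma measurable_ball_normalize A : measurable A ->
  measurable (ball `&` normalize @^-1` A).
Proof.
by move=> mA; apply: measurableI; [exact: measurable_punctured_ball|exact: preim_measurable].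
Qed.

Let cone_prob0 : cone_prob set0 = 0%E.
Proof. by rewrite /cone_prob preimage_set0 setI0 measure0 mul0e. Qed.

Let cone_prob_ge0 A : (0 <= cone_prob A)%E.
Proof.
rewrite mule_ge0 ?lebesgue_tuple_ge0// lee_fin invr_ge0 ltW//.
exact: fine_lebesgue_ball_gt0.
Qed.

Let cone_prob_additive : semi_sigma_additive cone_prob.
Proof.
move=> F mF tF mUF.
rewrite /cone_prob preimage_bigcup setI_bigcupr.
under eq_fun do rewrite -ge0_sume_distrl ?lebesgue_tuple_ge0//.
apply: cvgeZr => //; apply: measure_semi_sigma_additive.
- by move=> i; exact: measurable_ball_normalize.
- apply/trivIsetP => i j _ _ ij.
  move/trivIsetP : tF => /(_ i j Logic.I Logic.I ij) h.
  by rewrite setIACA -(preimage_setI normalize) h preimage_set0 setI0.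
- rewrite -setI_bigcupr -preimage_bigcup; exact: measurable_ball_normalize.
Qed.

HB.instance Definition _ := isMeasure.Build _ _ _ cone_prob
  cone_prob0 cone_prob_ge0 cone_prob_additive.

Let cone_probT : cone_prob setT = 1%E.
Proof.
rewrite /cone_prob preimage_setT setIT -(fineK lebesgue_ball_fin_num) -EFinM.
by rewrite mulfV// gt_eqF// fine_lebesgue_ball_gt0.
Qed.

HB.instance Definition _ := Measure_isProbability.Build _ _ _ cone_prob cone_probT.

Lemma cone_prob_sphereI A : cone_prob (A `&` @sphere R n) = cone_prob A.
Proof.
congr (lambda _ * _)%E; apply/seteqP; split => x /= -[xb].
  by case.
by move=> Ax; do 2 split => //; apply: dotR_normalize; case/andP: xb.
Qed.

Lemma cone_prob_reflect u A : measurable A ->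
  cone_prob (reflect u @^-1` A) = cone_prob A.
Proof.
move=> mA; congr (_ * _)%E.
rewrite -[RHS](lebesgue_tuple_reflect u (measurable_ball_normalize mA)).
congr lambda; apply/seteqP; split => x /=;
  by rewrite /punctured_ball/normalize/= dotR_reflect reflectZ.
Qed.

(** The factor [d] in [surface_measure] cancels, and the denominator becomes the volume of the
    ball. *)
Lemma surface_fraction A : A `<=` @sphere R n -> measurable A ->
  fine (surface_measure A) / fine (surface_measure (@sphere R n)) =
  fine (cone_prob A).
Proof.
move=> As mA; rewrite /surface_measure !coneE//.
rewrite (_ : ball `&` normalize @^-1` sphere n = ball); last first.
  by apply/seteqP; split => [x []//|x xb]; split => //;
    apply: dotR_normalize; case/andP: xb.
have fA : lambda (ball `&` normalize @^-1` A) \is a fin_num.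
  rewrite ge0_fin_numE ?lebesgue_tuple_ge0//.
  apply: le_lt_trans lebesgue_punctured_ball_lty; apply: le_measure.
  - by apply/mem_set; exact: measurable_ball_normalize.
  - by apply/mem_set; exact: measurable_punctured_ball.
  - exact: subIsetl.
rewrite /cone_prob -(fineK fA) -(fineK lebesgue_ball_fin_num) -!EFinM/=.
have := fine_lebesgue_ball_gt0; rewrite -(fineK lebesgue_ball_fin_num)/= => b0.
by rewrite invfM mulrACA mulfV ?mul1r// pnatr_eq0.
Qed.

End ConeProbability.

Lemma lebesgue_tupleS (R : realType) m (A : set (m.+1.-tuple R)) :
  lebesgue_tuple A =
  (\int[@lebesgue_measure R]_x lebesgue_tuple [set t | A (cons_tuple (x : R) t)])%E.
Proof. by []. Qed.

(** The cone over a point lies on a ray. Each slice at a first coordinate [x != 0] has at most one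
    point, which is null because the slice space has dimension at least 1. On the one-dimensional
    sphere [{-1, 1}] points would have mass 1/2. *)
Lemma cone_prob_set1 (R : realType) k (s : k.+2.-tuple R) :
  @cone_prob R k.+1 [set s] = 0%E.
Proof.
rewrite /cone_prob; set C := _ `&` _.
have mC : measurable C.
  by apply: measurable_ball_normalize; exact: measurable_tuple_set1.
have C_line v : C v -> exists2 r, 0 < r & v = scalet r s.
  move=> [/andP[v0 _] <-]; exists (Num.sqrt (dotR v v)); first by rewrite sqrtr_gt0.
  apply: eq_from_tnth => i; rewrite !tnth_scalet mulrA mulfV ?mul1r//.
  by rewrite gt_eqF// sqrtr_gt0.
rewrite lebesgue_tupleS.
rewrite (@ge0_negligible_integral _ _ _ (@lebesgue_measure R) setT [set 0])//;
  last 2 first.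
- exact: (measurable_fun_lebesgue_section mC).
- exact: lebesgue_measure_set1.
rewrite integral0_eq ?mul0e// => x [_ x0].
pose D : set (k.+1.-tuple R) := [set t | C (cons_tuple (x : R) t)].
suff : lebesgue_tuple D = 0%E by [].
have [[t Ct]|nC] := pselect (exists t, C (cons_tuple (x : R) t)); last first.
  rewrite (_ : D = set0) ?measure0// -subset0 => t Ct.
  by apply: nC; exists t.
apply/eqP; rewrite -measure_le0 -(lebesgue_tuple_set1 t).
apply: le_measure; try apply/mem_set.
- have := measurable_xsection x (measurable_pair_cons measurableT mC).
  by rewrite setTI; congr measurable; apply/seteqP; split => u; rewrite /xsection/= inE.
- exact: measurable_tuple_set1.
(* Two points of the ray with the same nonzero first coordinate have the same radius. *)
move=> u /= Cu; apply: eq_from_tnth => i.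
have [r r0 /(congr1 (fun v => (tnth v ord0, tnth v (lift ord0 i))))] := C_line _ Ct.
have [q q0 /(congr1 (fun v => (tnth v ord0, tnth v (lift ord0 i))))] := C_line _ Cu.
rewrite !tnthS !tnth0 !tnth_scalet => -[xq ->] [xr ->].
have s0 : tnth s ord0 != 0 by apply/eqP => s0; apply: x0; rewrite /= xq s0 mulr0.
by congr (_ * _); apply: (mulIf s0); rewrite -xq.
Qed.

Lemma measurable_set_le d (T : measurableType d) (R : realType) (f g : T -> R) :
  measurable_fun setT f -> measurable_fun setT g -> measurable [set x | f x <= g x].
Proof.
move=> mf mg; rewrite -[X in measurable X]setTI; exact: measurable_fun_le.
Qed.

Lemma measurable_set_lt d (T : measurableType d) (R : realType) (f g : T -> R) :
  measurable_fun setT f -> measurable_fun setT g -> measurable [set x | f x < g x].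
Proof.
move=> mf mg; rewrite (_ : [set x | _] = ~` [set x | g x <= f x]).
  by apply: measurableC; exact: measurable_set_le.
by apply/seteqP; split => x /=; rewrite ltNge => /negP.
Qed.

(** * Ranks of a random point *)

Section Quantile.
Context d (T : measurableType d) (R : realType) (nu : probability T R).

Lemma measure_bigcup_le (F : nat -> set T) (a : \bar R) :
  (forall n, measurable (F n)) -> nondecreasing_seq F ->
  (forall n, (nu (F n) <= a)%E) -> (nu (\bigcup_n F n) <= a)%E.
Proof.
move=> mF ndF Fa; have cF := nondecreasing_cvg_mu (mu := nu) mF
  (bigcup_measurable (fun n _ => mF n)) ndF.
rewrite -(cvg_lim _ cF)//; apply: lime_le; first by apply/cvg_ex; eexists; exact: cF.
exact: nearW.
Qed.

(** The set [S] of levels is closed upwards, so it is empty, the whole line, or a closed or open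
    half-line. In the nonempty cases the event is a superlevel set of [f] at a level of [S], or an
    increasing union of such sets, each of mass at most [a]. *)
Lemma quantile_le (f : T -> R) (a : R) : measurable_fun setT f -> 0 <= a ->
  (nu [set t | (nu [set s | (f t <= f s)%R] <= a%:E)%E] <= a%:E)%E.
Proof.
move=> mf a0; have mle c : measurable [set t | c <= f t] by exact: measurable_set_le.
pose S := [set x : R | (nu [set s | (x <= f s)%R] <= a%:E)%E].
have Sup x y : x <= y -> S x -> S y.
  move=> xy; rewrite /S/=; apply: le_trans; apply: le_measure; rewrite ?inE//.
  by move=> s /=; exact: le_trans.
have union (x_ : nat -> R) : (forall n, S (x_ n)) ->
    {homo x_ : n m / (n <= m)%N >-> m <= n} ->
    [set t | S (f t)] `<=` \bigcup_n [set t | x_ n <= f t] ->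
    (nu [set t | S (f t)] <= a%:E)%E.
  move=> Sx dx Sub; have -> : [set t | S (f t)] = \bigcup_n [set t | x_ n <= f t].
    by apply/seteqP; split => // t [n _ /= xt]; exact: Sup xt (Sx n).
  apply: measure_bigcup_le => // n m nm; apply/subsetPset => t /=.
  by apply: le_trans; exact: dx.
have [S0|S0] := pselect (S !=set0); last first.
  rewrite (_ : [set t | _] = set0) ?measure0 ?lee_fin// -subset0 => t St.
  by apply: S0; exists (f t).
(* Without a lower bound every real is a level of [S], and the levels [-n] exhaust the space. *)
have [lS|nlS] := pselect (has_lbound S); last first.
  apply: (union (fun n => - n%:R)) => [n| |t _].
  - have [x [Sx xn]] : exists x, S x /\ x < - n%:R.
      apply: contrapT => h; apply: nlS; exists (- n%:R) => x Sx.
      by rewrite leNgt; apply/negP => xn; apply: h; exists x.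
    by apply: Sup Sx; exact: ltW.
  - by move=> n m nm; rewrite lerN2 ler_nat.
  exists (Num.truncn (`|f t|)).+1 => //=.
  rewrite lerNl (le_trans (ler_norm _))// normrN ltW// truncnS_gt//.
have hS : has_inf S by [].
have [Sc|nSc] := pselect (S (inf S)).
  rewrite (_ : [set t | _] = [set t | inf S <= f t])//.
  apply/seteqP; split => t /=; first exact: (ge_inf lS).
  by move=> h; exact: Sup h Sc.
(* The infimum is not attained: the half-line is open and is approached from inside by levels
   decreasing to it. *)
apply: (union (fun n => inf S + n.+1%:R^-1)) => [n| |t /= St].
- have /(inf_adherent)/(_ hS)[x Sx xn] : 0 < n.+1%:R^-1 :> R by rewrite invr_gt0.
  by apply: Sup Sx; exact: ltW.
- by move=> n m nm; rewrite lerD2l lef_pV2 ?posrE// ler_nat.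
have cf : 0 < f t - inf S.
  rewrite subr_gt0 lt_neqAle (ge_inf lS St) andbT.
  by apply/eqP => cf; apply: nSc; rewrite cf.
exists (Num.truncn (f t - inf S)^-1) => //=.
rewrite -lerBrDl -[leRHS]invrK lef_pV2 ?posrE ?invr_gt0//.
by rewrite ltW// truncnS_gt.
Qed.

Lemma measurable_rank_ge (f : T -> R) : measurable_fun setT f ->
  measurable_fun setT (fun t => nu [set s | f t <= f s]).
Proof.
move=> mf; have mS : measurable [set p : T * T | f p.1 <= f p.2].
  by apply: measurable_set_le; exact: measurableT_comp.
have := measurable_fun_xsection nu mS; apply: eq_measurable_fun => t _ /=.
by congr (nu _); apply/seteqP; split => s; rewrite /xsection/= inE.
Qed.

Lemma measurable_rank_gt (f : T -> R) : measurable_fun setT f ->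
  measurable_fun setT (fun t => nu [set s | f t < f s]).
Proof.
move=> mf; have mS : measurable [set p : T * T | f p.1 < f p.2].
  by apply: measurable_set_lt; exact: measurableT_comp.
have := measurable_fun_xsection nu mS; apply: eq_measurable_fun => t _ /=.
by congr (nu _); apply/seteqP; split => s; rewrite /xsection/= inE.
Qed.

Lemma measurable_ereal_gt (F : T -> \bar R) (a : \bar R) :
  measurable_fun setT F -> measurable [set t | (a < F t)%E].
Proof.
move=> mF; rewrite -[X in measurable X]setTI.
by apply: (@measurable_lte _ _ _ _ _ (fun=> a)).
Qed.

(** Complement of [quantile_le]. Counting ties in the rank makes this lower bound valid for every
    [f]. *)
Lemma rank_ge_quantile (f : T -> R) (a : R) : measurable_fun setT f -> 0 <= a ->
  ((1 - a)%:E <= nu [set t | (a%:E < nu [set s | (f t <= f s)%R])%E])%E.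
Proof.
move=> mf a0; set A := [set t | _].
have mA : measurable A by apply: measurable_ereal_gt; exact: measurable_rank_ge.
rewrite -[A]setCK probability_setC; last exact: measurableC.
rewrite EFinB leeB// (_ : ~` A = [set t | (nu [set s | (f t <= f s)%R] <= a%:E)%E]).
  exact: quantile_le.
by apply/seteqP; split => t; rewrite /A/= leNgt => /negP.
Qed.

(** [quantile_le] for [- f] and [1 - a]: a strict rank above [a] leaves mass less than [1 - a] at or
    below [f t]. *)
Lemma rank_gt_quantile (f : T -> R) (a : R) : measurable_fun setT f -> a <= 1 ->
  (nu [set t | (a%:E < nu [set s | (f t < f s)%R])%E] <= (1 - a)%:E)%E.
Proof.
move=> mf a1; have mNf : measurable_fun setT (fun t => - f t).
  exact: measurableT_comp.
have a1' : 0 <= 1 - a by rewrite subr_ge0.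
apply: le_trans (quantile_le mNf a1'); apply: le_measure; rewrite ?inE//.
- by apply: measurable_ereal_gt; exact: measurable_rank_gt.
- rewrite (_ : [set t | _] = ~` [set t |
    ((1 - a)%:E < nu [set s | (- f t <= - f s)%R])%E]).
    by apply: measurableC; apply: measurable_ereal_gt; exact: measurable_rank_ge.
  by apply/seteqP; split => t /=; rewrite leNgt => /negP.
move=> t /= at_.
rewrite (_ : [set s | _] = ~` [set s | (f t < f s)%R]); last first.
  by apply/seteqP; split => s /=; rewrite lerN2 leNgt => /negP.
rewrite probability_setC; last exact: measurable_set_lt.
by rewrite EFinB leeB// ltW.
Qed.

End Quantile.

(** * Centred Gaussian laws *)

Section NormalScaling.
Variable R : realType.
Notation mu := (@lebesgue_measure R).

Lemma lebesgue_measure_scale (s : R) (A : set R) : 0 < s -> measurable A ->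
  mu A = (s%:E * mu ((fun x : R => (s * x)%R) @^-1` A))%E.
Proof.
move=> s0 mA.
have mf : measurable_fun [set: measurableTypeR R]
    ((fun x => s * x) : measurableTypeR R -> measurableTypeR R).
  exact: (measurable_funM (f := fun=> s)).
pose nu : {measure set (measurableTypeR R) -> \bar R} :=
  mscale (NngNum (ltW s0)) (pushforward_measure mu mf).
apply: (@lebesgue_measure_unique _ nu) => // X [[x y] _ <-].
rewrite /nu/= /mscale/= /pushforward.
rewrite (_ : _ @^-1` _ = `]x / s, y / s]%classic); last first.
  apply/seteqP; split => u /=; rewrite !in_itv/=;
    by rewrite ltr_pdivrMr// ler_pdivlMr// (mulrC u).
rewrite !lebesgue_measure_itv/= !lte_fin ltr_pM2r ?invr_gt0//.
case: ifP => _; last by rewrite mule0.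
by rewrite -!EFinB -EFinM mulrBr !(mulrC s) !divfK ?gt_eqF.
Qed.

Lemma ge0_integral_scale (s : R) (f : R -> \bar R) : 0 < s ->
  measurable_fun setT f -> (forall x, (0 <= f x)%E) ->
  (\int[mu]_x f x = s%:E * \int[mu]_x f (s * (x : R))%R)%E.
Proof.
move=> s0 mf f0; pose tr : measurableTypeR R -> measurableTypeR R := fun x : R => s * x.
have mtr : measurable_fun setT tr.
  exact: (measurable_funM (f := fun=> s)).
transitivity (\int[mscale (NngNum (ltW s0)) (pushforward_measure mu mtr)]_x f x)%E.
  apply: eq_measure_integral => A mA _.
  exact: lebesgue_measure_scale.
rewrite ge0_integral_mscale//=; congr (_ * _)%E.
by rewrite ge0_integral_pushforward.
Qed.

Lemma normal_pdf_scale (s x : R) : 0 < s ->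
  s * normal_pdf 0 s (s * x) = normal_pdf 0 1 x.
Proof.
move=> s0; rewrite !normal_pdfE ?gt_eqF// /normal_peak /normal_fun !subr0 mulrA.
congr (_ * expR _); last by field; rewrite gt_eqF.
rewrite expr1n mul1r -mulrnAr sqrtrM ?sqr_ge0// sqrtr_sqr gtr0_norm//.
by rewrite invfM mulrA mulfV ?mul1r ?gt_eqF.
Qed.

Lemma normal_prob_scale (s : R) (A : set R) : 0 < s -> measurable A ->
  normal_prob 0 s A = normal_prob 0 1 ((fun x => s * x) @^-1` A).
Proof.
move=> s0 mA; rewrite /normal_prob integral_mkcond [RHS]integral_mkcond.
set F := (X in (\int[mu]_x X x)%E = _).
have F0 y : (0 <= F y)%E.
  by rewrite /F patchE; case: ifP => // _; rewrite lee_fin normal_pdf_ge0.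
have mF : measurable_fun setT F.
  apply/(measurable_restrictT _ mA)/measurable_funTS/measurable_EFinP.
  exact: measurable_normal_pdf.
have ms : measurable_fun setT (fun x : R => s * x).
  exact: (measurable_funM (f := fun=> s)).
rewrite (@ge0_integral_scale s)// -ge0_integralZl//; last 3 first.
- exact: (measurableT_comp mF ms).
- by move=> x _; exact: F0.
- by rewrite lee_fin ltW.
apply: eq_integral => x _; rewrite /F !patchE.
rewrite (_ : (s * x \in A) = ((x : R) \in (fun x => s * x) @^-1` A)); last first.
  by apply/idP/idP; rewrite !inE.
case: ifP => _; last by rewrite mule0.
by rewrite -EFinM normal_pdf_scale.
Qed.

(** The centred normal law with parameter [s] has second moment [s ^+ 2] times this constant; its
    being nonzero lets the variance determine [s]. *)
Definition normal_second_moment : \bar R := (\int[normal_prob 0 (1 : R)]_x (x ^+ 2)%:E)%E.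

Lemma normal_prob_set10 (s : R) : s != 0 -> normal_prob 0 s [set 0] = 0%E.
Proof.
move=> s0; have /null_content_dominatesP := @normal_prob_dominates R 0 s.
by apply => //; exact: lebesgue_measure_set1.
Qed.

Lemma normal_second_moment_neq0 : normal_second_moment != 0%E.
Proof.
apply/eqP => m0.
have msq : measurable_fun setT (fun x : R => (x ^+ 2)%:E).
  by apply/measurable_EFinP; exact: measurable_funX.
have /ae_eq_integral_abs : (\int[normal_prob 0 (1 : R)]_x `|(x ^+ 2)%:E| = 0)%E.
  rewrite -[RHS]m0; apply: eq_integral => x _.
  by rewrite gee0_abs// lee_fin sqr_ge0.
move=> /(_ measurableT msq)[N [mN N0 subN]].
pose O : set (measurableTypeR R) := [set (0 : R)].
have O0 : normal_prob 0 (1 : R) O = 0%E by apply: normal_prob_set10.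
have : normal_prob 0 (1 : R) (N `|` O) = 0%E.
  apply: null_set_setU => //; exact: (@measurable_set1 R).
rewrite (_ : N `|` O = setT).
  by move=> /eqP; rewrite [X in X == _]probability_setT eqe oner_eq0.
apply/seteqP; split => // x _; have [x0|x0] := pselect ((x : R) = 0).
  by right.
by left; apply: subN => /= /(_ Logic.I)[] /eqP; rewrite sqrf_eq0 => /eqP.
Qed.

End NormalScaling.

Section CenteredGaussian.
Context {R : realType} d (T : measurableType d) (P : probability T R).
Implicit Type Z : T -> R.

Lemma gaussian_second_momentE Z (s : R) : measurable_fun setT Z -> 0 <= s ->
  (forall B, measurable B -> P (Z @^-1` B) =
    (if s == 0 then \d_(0:R) B else normal_prob 0 s B)) ->
  (\int[P]_w (Z w ^+ 2)%:E = (s ^+ 2)%:E * normal_second_moment R)%E.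
Proof.
move=> mZ s0 lawZ.
have msq : measurable_fun setT (fun x : R => (x ^+ 2)%:E).
  by apply/measurable_EFinP; exact: measurable_funX.
have sq0 (x : R) : (0 <= (x ^+ 2)%:E)%E by rewrite lee_fin sqr_ge0.
transitivity (\int[pushforward P Z]_x (x ^+ 2)%:E)%E.
  by rewrite ge0_integral_pushforward.
have [sE|sn0] := eqVneq s 0.
  rewrite sE expr0n/= mul0e (eq_measure_integral (dirac (0 : R))).
    by rewrite integral_dirac// diracT expr0n mul1e.
  by move=> A mA _; rewrite [LHS]lawZ// sE eqxx.
have {sn0}s0 : 0 < s by rewrite lt_neqAle eq_sym sn0.
have ms : measurable_fun setT (fun x : R => s * x).
  exact: (measurable_funM (f := fun=> s)).
transitivity (\int[pushforward (normal_prob 0 (1:R)) (fun x : R => (s * x)%R)]_x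
    (x ^+ 2)%:E)%E.
  apply: eq_measure_integral => A mA _.
  by rewrite [LHS]lawZ// gt_eqF// normal_prob_scale.
rewrite ge0_integral_pushforward//.
rewrite preimage_setT.
transitivity (\int[normal_prob 0 (1:R)]_x ((s ^+ 2)%:E * (x ^+ 2)%:E))%E.
  by apply: eq_integral => x _ /=; rewrite exprMn EFinM.
by rewrite ge0_integralZl// lee_fin sqr_ge0.
Qed.

Lemma centered_gaussian_neq0 Z : centered_gaussian P Z ->
  (\int[P]_w (Z w ^+ 2)%:E != 0)%E -> P (Z @^-1` [set 0]) = 0%E.
Proof.
move=> [mZ [s [s0 lawZ]]]; rewrite (gaussian_second_momentE mZ s0 lawZ) => v0.
have sn0 : s != 0 by apply: contra_neq v0 => ->; rewrite expr0n mul0e.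
by rewrite lawZ// (negbTE sn0) normal_prob_set10.
Qed.

Lemma centered_gaussian_law Z Z' (v : R) :
  centered_gaussian P Z -> centered_gaussian P Z' ->
  (\int[P]_w (Z w ^+ 2)%:E = v%:E)%E -> (\int[P]_w (Z' w ^+ 2)%:E = v%:E)%E ->
  forall B, measurable B -> P (Z @^-1` B) = P (Z' @^-1` B).
Proof.
move=> [mZ [s [s0 lawZ]]] [mZ' [s' [s'0 lawZ']]].
rewrite (gaussian_second_momentE mZ s0 lawZ).
rewrite (gaussian_second_momentE mZ' s'0 lawZ') => vE v'E.
suff ss' : s = s' by move=> B mB; rewrite lawZ// lawZ'// ss'.
have := normal_second_moment_neq0 R.
have : (0 <= normal_second_moment R)%E.
  by apply: integral_ge0 => x _; rewrite lee_fin sqr_ge0.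
(* Treats the value [+oo] of the constant: a finite second moment then forces the parameter to be
   0. *)
have inf0 (u : R) : 0 <= u -> ((u ^+ 2)%:E * +oo = v%:E)%E -> u = 0.
  rewrite le_eqVlt => /predU1P[//|u0].
  by rewrite gt0_muley ?lte_fin ?exprn_gt0.
case: (normal_second_moment R) vE v'E => [m| |]//.
  move=> [vE] [v'E] m0 mn0; apply: (@pexpIrn _ 2) => //.
  by apply: (mulIf mn0); rewrite vE v'E.
by move=> /(inf0 _ s0)-> /(inf0 _ s'0)->.
Qed.

End CenteredGaussian.

(** * Variance of linear combinations of increments *)

Section ZeroSumCombination.
Context {R : realType}.

(** Expanding [(x_i - x_j) ^+ 2], the pure squares are multiplied by the sum of the coefficients and
    vanish; the cross terms rebuild the square. *)
Lemma zero_sum_square n (c x : 'I_n -> R) : \sum_i c i = 0 ->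
  (\sum_i c i * x i) ^+ 2 =
  \sum_(p : 'I_n * 'I_n) - (1 / 2) * (c p.1 * c p.2) * (x p.1 - x p.2) ^+ 2.
Proof.
move=> c0; rewrite -(pair_bigA _ (fun i j => - (1 / 2) * (c i * c j) * (x i - x j) ^+ 2))/=.
(* The two added terms are zero because the coefficients sum to 0; they complete each product
   [x_i x_j] to a squared difference. *)
transitivity (\sum_i (c i * x i * (\sum_j c j * x j)
    + - (1 / 2) * (c i * x i ^+ 2) * (\sum_j c j)
    + - (1 / 2) * c i * (\sum_j c j * x j ^+ 2))).
  rewrite !big_split/= -!mulr_suml c0 mulr0 addr0 -mulr_sumr c0 mulr0 mul0r addr0.
  by rewrite expr2.
apply: eq_bigr => i _; rewrite !mulr_sumr -!big_split/=.
by apply: eq_bigr => j _; field.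
Qed.

Context d (T : measurableType d) (P : probability T R).

Lemma zero_sum_second_moment n (c : 'I_n -> R) (x : 'I_n -> T -> R)
    (v : 'I_n -> 'I_n -> R) :
  (forall i, measurable_fun setT (x i)) ->
  (forall i j, (\int[P]_w ((x i w - x j w) ^+ 2)%:E = (v i j)%:E)%E) ->
  \sum_i c i = 0 ->
  (\int[P]_w ((\sum_i c i * x i w) ^+ 2)%:E =
    (\sum_(p : 'I_n * 'I_n) - (1 / 2) * (c p.1 * c p.2) * v p.1 p.2)%:E)%E.
Proof.
move=> mx xv c0.
have isq (p : 'I_n * 'I_n) :
    P.-integrable setT (fun w => ((x p.1 w - x p.2 w) ^+ 2)%:E).
  apply/integrableP; split.
    by apply/measurable_EFinP; apply: measurable_funX; exact: measurable_funB.
  rewrite (eq_integral (fun w => ((x p.1 w - x p.2 w) ^+ 2)%:E)) ?xv ?ltry//.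
  by move=> w _; rewrite gee0_abs// lee_fin sqr_ge0.
transitivity (\int[P]_w (\sum_(p : 'I_n * 'I_n)
    (- (1 / 2) * (c p.1 * c p.2))%:E * ((x p.1 w - x p.2 w) ^+ 2)%:E))%E.
  by apply: eq_integral => w _; rewrite zero_sum_square// sumEFin.
rewrite integral_sum//; last by move=> p; exact: integrableZl.
by rewrite -sumEFin; apply: eq_bigr => p _; rewrite integralZl// xv.
Qed.

End ZeroSumCombination.

Section ZeroSumPairs.
Context {R : realType} {T S : Type} (X X' : T -> S -> R) (D : set S).

(** Combinations with coefficients of sum zero are the linear combinations of increments. The same
    points and coefficients are used on both sides, with [X'] later taken as the reflected
    process. *)
Definition zero_sum_pair (z z' : T -> R) := exists n (t : 'I_n -> S) (c : 'I_n -> R),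
  [/\ forall i, D (t i), \sum_i c i = 0,
      z = (fun w => \sum_i c i * X w (t i)) &
      z' = (fun w => \sum_i c i * X' w (t i))].

Lemma zero_sum_pair0 : zero_sum_pair (fun=> 0) (fun=> 0).
Proof.
have e0 : 'I_0 -> S by case.
exists 0%N, e0, (fun=> 0); split; first by case.
- by rewrite big_ord0.
- by apply/funext => w; rewrite big_ord0.
- by apply/funext => w; rewrite big_ord0.
Qed.

Lemma zero_sum_pair_lin z z' y y' (a : R) :
  zero_sum_pair z z' -> zero_sum_pair y y' ->
  zero_sum_pair (fun w => z w + a * y w) (fun w => z' w + a * y' w).
Proof.
move=> [n [t [c [tD c0 -> ->]]]] [m [u [e [uD e0 -> ->]]]].
pose tu (i : 'I_(n + m)) := match fintype.split i with inl j => t j | inr j => u j end.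
pose ce (i : 'I_(n + m)) := match fintype.split i with inl j => c j | inr j => a * e j end.
have sl j : fintype.split (lshift m j) = inl j := unsplitK (inl j : 'I_n + 'I_m).
have sr j : fintype.split (rshift n j) = inr j := unsplitK (inr j : 'I_n + 'I_m).
exists (n + m)%N, tu, ce; split.
- by move=> i; rewrite /tu; case: fintype.split.
- rewrite big_split_ord/= /ce; under eq_bigr do rewrite sl.
  by under [X in _ + X]eq_bigr do rewrite sr; rewrite c0 -mulr_sumr e0 mulr0 addr0.
- apply/funext => w; rewrite big_split_ord/= /ce /tu mulr_sumr; congr (_ + _).
    by apply: eq_bigr => j _; rewrite sl.
  by apply: eq_bigr => j _; rewrite sr mulrA.
- apply/funext => w; rewrite big_split_ord/= /ce /tu mulr_sumr; congr (_ + _).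
    by apply: eq_bigr => j _; rewrite sl.
  by apply: eq_bigr => j _; rewrite sr mulrA.
Qed.

Lemma zero_sum_pair_increment s t : D s -> D t ->
  zero_sum_pair (fun w => X w s - X w t) (fun w => X' w s - X' w t).
Proof.
move=> Ds Dt; exists 2%N, (fun i => if i == ord0 then s else t),
  (fun i => if i == ord0 then 1 else -1); split.
- by move=> i; case: ifP.
- by rewrite !big_ord_recl big_ord0/=; ring.
- by apply/funext => w; rewrite !big_ord_recl big_ord0/=; ring.
- by apply/funext => w; rewrite !big_ord_recl big_ord0/=; ring.
Qed.

End ZeroSumPairs.

(** * Spherical fractional Brownian motion *)

(** Nonnegativity of [|s - t|^2] and [|s + t|^2] puts the inner product in [[-1, 1]], where [acos]
    vanishes only at 1; the value 1 would give [|s - t|^2 = 0]. *)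
Lemma geod_gt0 (R : realType) n (s t : n.-tuple R) :
  sphere n s -> sphere n t -> s <> t -> 0 < geod s t.
Proof.
rewrite /sphere/= => s1 t1 st.
have st1 : dotR s t <= 1.
  have := dotR_ge0 (addt s (scalet (-1) t)).
  by rewrite !(dotRDl, dotRDr, dotRZl, dotRZr) s1 t1 (dotRC t s); lra.
have st2 : -1 <= dotR s t.
  have := dotR_ge0 (addt s t).
  by rewrite !(dotRDl, dotRDr) s1 t1 (dotRC t s); lra.
have st11 : -1 <= dotR s t <= 1 by rewrite st1 st2.
rewrite lt_neqAle acos_ge0// andbT; apply/eqP => g0; apply: st.
have st0 : dotR s t = 1 by rewrite -(acosK st11) -/(geod s t) -g0 cos0.
have d0 : dotR (addt s (scalet (-1) t)) (addt s (scalet (-1) t)) = 0.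
  by rewrite !(dotRDl, dotRDr, dotRZl, dotRZr) s1 t1 (dotRC t s) st0; ring.
apply: eq_from_tnth => i; have := dotR_eq0 d0 i.
by rewrite !(tnth_addt, tnth_scalet) => ?; lra.
Qed.

Section SphericalFBm.
Context (R : realType) (k : nat) (H : R) (dO : measure_display)
  (Omega : measurableType dO) (P : probability Omega R)
  (X : Omega -> k.+2.-tuple R -> R).
Notation S := (@sphere R k.+2).
Notation nu := (@cone_prob R k.+1).
Hypothesis X_gaussian : centered_gaussian_process P S X.
Hypothesis X_increment : forall s t, S s -> S t ->
  (\int[P]_w ((X w s - X w t) ^+ 2)%:E)%E = ((geod s t) `^ (2 * H))%:E.
Hypothesis X_measurable :
  measurable_fun (setT `*` S) (fun p : Omega * k.+2.-tuple R => X p.1 p.2).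

Lemma measurable_fBm s : S s -> measurable_fun setT (X ^~ s).
Proof.
move=> Ss; have [+ _] := @X_gaussian 1 (fun=> s) (fun=> 1) (fun=> Ss).
by under eq_fun do rewrite big_ord_recl big_ord0 mul1r addr0.
Qed.

(** Both combinations are centred Gaussian, and their variances are the same function of geodesic
    distances, which the reflection preserves. *)
Lemma fBm_zero_sum_law u z z' :
  zero_sum_pair X (fun w s => X w (reflect u s)) S z z' ->
  [/\ measurable_fun setT z, measurable_fun setT z' &
  forall B, measurable B -> P (z @^-1` B) = P (z' @^-1` B)].
Proof.
move=> [n [t [c [St c0 zE z'E]]]].
have Srt i : S (reflect u (t i)) by rewrite /sphere/= dotR_reflect; exact: St.
have gz : centered_gaussian P z by rewrite zE; exact: X_gaussian.
have gz' : centered_gaussian P z' by rewrite z'E; exact: (X_gaussian _ Srt).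
split; [exact: gz.1|exact: gz'.1|].
pose v i j := geod (t i) (t j) `^ (2 * H).
apply: (centered_gaussian_law gz gz'
  (v := \sum_(p : 'I_n * 'I_n) - (1 / 2) * (c p.1 * c p.2) * v p.1 p.2)).
- rewrite zE; apply: (zero_sum_second_moment (x := fun i w => X w (t i))) => //.
    by move=> i; exact: measurable_fBm.
  by move=> i j; exact: X_increment.
- rewrite z'E.
  apply: (zero_sum_second_moment (x := fun i w => X w (reflect u (t i)))) => //.
    by move=> i; exact: measurable_fBm.
  by move=> i j; rewrite X_increment// /geod dotR_reflect.
Qed.

Lemma fBm_tie s t : S s -> S t -> s <> t -> P [set w | X w s = X w t] = 0%E.
Proof.
move=> Ss St st.
have Sf (i : 'I_2) : S (if i == ord0 then s else t) by case: ifP.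
have := X_gaussian (fun i : 'I_2 => if i == ord0 then 1 else -1) Sf.
rewrite (_ : (fun w => _) = (fun w => X w s - X w t)); last first.
  by apply/funext => w; rewrite !big_ord_recl big_ord0/=; ring.
move=> /centered_gaussian_neq0; rewrite X_increment// => h.
rewrite (_ : [set w | _] = (fun w => X w s - X w t) @^-1` [set 0]).
  by apply: h; rewrite eqe gt_eqF// powR_gt0// geod_gt0.
by apply/seteqP; split => w /=; [move=> ->; rewrite subrr|move/subr0_eq].
Qed.

(** [X] is jointly measurable only over the sphere. The extension by 0 is measurable on the whole
    product space, as the product measure arguments require. *)
Definition fBm0 (w : Omega) (s : k.+2.-tuple R) : R :=
  ((fun p : Omega * k.+2.-tuple R => X p.1 p.2) \_ (setT `*` S)) (w, s).

Lemma fBm0E w s : S s -> fBm0 w s = X w s.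
Proof. by move=> Ss; rewrite /fBm0 patchE ifT// inE. Qed.

Lemma measurable_fBm0 d (T : measurableType d) (f : T -> Omega)
    (g : T -> k.+2.-tuple R) :
  measurable_fun setT f -> measurable_fun setT g ->
  measurable_fun setT (fun x => fBm0 (f x) (g x)).
Proof.
move=> mf mg.
have mD : measurable ([set: Omega] `*` S).
  by apply: measurableX => //; exact: measurable_sphere.
have /(measurable_restrictT _ mD) mY := X_measurable.
exact: (measurableT_comp mY (measurable_fun_pair mf mg)).
Qed.

(** The [G(t)] of the overview. *)
Definition exceed (w : Omega) (t : k.+2.-tuple R) : \bar R :=
  nu [set s | fBm0 w t < fBm0 w s].

Lemma measurable_exceed_set w t : measurable [set s | fBm0 w t < fBm0 w s].
Proof. by apply: measurable_set_lt; exact: measurable_fBm0. Qed.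

Lemma measurable_exceed d (T : measurableType d) (f : T -> Omega)
    (g : T -> k.+2.-tuple R) :
  measurable_fun setT f -> measurable_fun setT g ->
  measurable_fun setT (fun x => exceed (f x) (g x)).
Proof.
move=> mf mg; pose E := [set p : T * k.+2.-tuple R |
  fBm0 (f p.1) (g p.1) < fBm0 (f p.1) p.2].
have mE : measurable E.
  apply: measurable_set_lt; apply: measurable_fBm0 => //;
    exact: measurableT_comp.
have := measurable_fun_xsection nu mE; apply: eq_measurable_fun => x _ /=.
by congr (nu _); apply/seteqP; split => s; rewrite /xsection/= inE.
Qed.

Lemma exceed_fin_num w t : exceed w t \is a fin_num.
Proof. exact: fin_num_measure (measurable_exceed_set w t). Qed.

(* The reflection u exchanges the points t and reflect u t while preserving
   both the law of the increments of X and the measure nu. *)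
Lemma exceed_law_reflect u t (a : R) : S t ->
  P [set w | (a%:E < exceed w t)%E] =
  P [set w | (a%:E < exceed w (reflect u t))%E].
Proof.
move=> St; set t' := reflect u t.
have St' : S t' by rewrite /sphere/= dotR_reflect.
pose L := zero_sum_pair X (fun w s => X w (reflect u s)) S.
have Lmeas z z' : L z z' -> measurable_fun setT z /\ measurable_fun setT z'.
  by move=> /fBm_zero_sum_law[].
have Llaw z z' : L z z' -> forall B, measurable B ->
    P (z @^-1` B) = P (z' @^-1` B) by move=> /fBm_zero_sum_law[].
have L0 : L (fun=> 0) (fun=> 0) := zero_sum_pair0 _ _ _.
have Llin z z' y y' c : L z z' -> L y y' ->
    L (fun x => z x + c * y x) (fun x => z' x + c * y' x).
  exact: zero_sum_pair_lin.
pose E (v : k.+2.-tuple R) := [set p : Omega * k.+2.-tuple R |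
  S p.2 /\ fBm0 p.1 v < fBm0 p.1 p.2].
have mE v : measurable (E v).
  apply: measurableI.
    rewrite -[X in measurable X]setTI.
    exact: (@measurable_snd _ _ _ _ measurableT _ (@measurable_sphere R k.+1)).
  by apply: measurable_set_lt; apply: measurable_fBm0.
pose rho (p : Omega * k.+2.-tuple R) := (p.1, reflect u p.2).
have mrho : measurable_fun setT rho.
  apply: measurable_fun_pair => //.
  exact: (measurableT_comp (measurable_reflect u)).
pose K : Omega * k.+2.-tuple R -> R := \1_(E t).
(* Composing with [rho] pairs [s] with [reflect u s]: for each [s] the compared increments
   [X_s - X_t] and their reflections form a pair of [L]. Invariance of [nu] undoes the substitution
   after integration. *)
pose K' : Omega * k.+2.-tuple R -> R := \1_(E t') \o rho.
have mK : measurable_fun setT K by exact: measurable_indic.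
have mK' : measurable_fun setT K' by exact: measurableT_comp.
have bK : bounded_measurable K.
  by split => //; exists 1 => p; rewrite /K indicE; case: (_ \in _); rewrite /= ?normr1 ?normr0.
have bK' : bounded_measurable K'.
  by split => //; exists 1 => p; rewrite /K'/= indicE; case: (_ \in _); rewrite /= ?normr1 ?normr0.
have mult s : multiplier P L (fun w => K (w, s)) (fun w => K' (w, s)).
  (* Off the sphere both indicators vanish, since reflections preserve the norm. *)
  have [Ss|nSs] := pselect (S s); last first.
    have -> : (fun w => K (w, s)) = (fun=> 0).
      apply/funext => w; rewrite /K indicE memNset// => -[].
      by [].
    have -> : (fun w => K' (w, s)) = (fun=> 0).
      apply/funext => w; rewrite /K'/= indicE memNset// => -[].
      by rewrite /sphere/= dotR_reflect.
    exact: multiplier_cst.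
  have Srs : S (reflect u s) by rewrite /sphere/= dotR_reflect.
  have := @multiplier_gt0_linear _ _ _ P L Lmeas L0 Llin _ _
    (zero_sum_pair_increment X (fun w s => X w (reflect u s)) Ss St).
  congr (multiplier P L); apply/funext => w.
    rewrite /K indicE subr_gt0; congr (nat_of_bool _)%:R.
    by apply/idP/idP; rewrite inE /E/= !fBm0E// => -[].
  rewrite /K'/= indicE subr_gt0; congr (nat_of_bool _)%:R.
  by apply/idP/idP; rewrite inE /E/= !fBm0E// => -[].
have intK w : \int[nu]_s K (w, s) = fine (exceed w t).
  rewrite /Rintegral/exceed -cone_prob_sphereI -[X in nu X]setTI setIC.
  rewrite -integral_indic//; last first.
    apply: measurableI; first exact: measurable_exceed_set.
    exact: measurable_sphere.
  congr fine; apply: eq_integral => s _; rewrite /K !indicE.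
  by congr ((nat_of_bool _)%:R%:E); apply/idP/idP; rewrite !inE /E/= => -[].
have intK' w : \int[nu]_s K' (w, s) = fine (exceed w t').
  have mA : measurable ([set s | fBm0 w t' < fBm0 w s] `&` S).
    apply: measurableI; first exact: measurable_exceed_set.
    exact: measurable_sphere.
  rewrite /Rintegral/exceed -cone_prob_sphereI -(cone_prob_reflect u mA).
  rewrite -[X in nu X]setTI setIC -integral_indic//; last first.
    by rewrite -[X in measurable X]setTI; exact: measurable_reflect.
  congr fine; apply: eq_integral => s _; rewrite /K'/= !indicE.
  by congr ((nat_of_bool _)%:R%:E); apply/idP/idP; rewrite !inE /E/= => -[].
have multG : multiplier P L (fun w => fine (exceed w t)) (fun w => fine (exceed w t')).
  have := multiplier_integral Lmeas nu bK bK' mult.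
  by under eq_fun do rewrite intK; under [X in multiplier _ _ _ X]eq_fun do rewrite intK'.
(* The indicator of [G - a > 0] is a multiplier, and its expectation is the probability in
   question. *)
have := multiplier_Rintegral Lmeas Llaw L0 (multiplier_gt0 Lmeas
  (multiplierD Lmeas multG (multiplier_cst P Lmeas (- a)))).
have PE v : \int[P]_w ((0 < fine (exceed w v) + - a)%R%:R) =
    fine (P [set w | (a%:E < exceed w v)%E]).
  have mA : measurable [set w | (a%:E < exceed w v)%E].
    by apply: measurable_ereal_gt; exact: measurable_exceed.
  rewrite /Rintegral -[X in P X]setTI setIC -integral_indic//.
  congr fine; apply: eq_integral => w _; rewrite indicE subr_gt0.
  congr ((nat_of_bool _)%:R%:E); rewrite -lte_fin fineK ?exceed_fin_num//.
  by apply/idP/idP; rewrite inE.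
have finP v : P [set w | (a%:E < exceed w v)%E] \is a fin_num.
  apply: fin_num_measure; apply: measurable_ereal_gt; exact: measurable_exceed.
move=> GG'; have fG : fine (P [set w | (a%:E < exceed w t)%E]) =
    fine (P [set w | (a%:E < exceed w t')%E]).
  exact: etrans (esym (PE t)) (etrans GG' (PE t')).
exact: etrans (esym (fineK (finP t))) (etrans (congr1 EFin fG) (fineK (finP t'))).
Qed.

Lemma exceed_law_constant t t' (a : R) : S t -> S t' ->
  P [set w | (a%:E < exceed w t)%E] = P [set w | (a%:E < exceed w t')%E].
Proof.
move=> St St'; have := exceed_law_reflect (addt t (scalet (-1) t')) a St.
by rewrite reflect_swap.
Qed.

Definition weakly_exceed (w : Omega) (t : k.+2.-tuple R) : \bar R :=
  nu [set s | fBm0 w t <= fBm0 w s].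

Lemma measurable_weakly_exceed d (T : measurableType d) (f : T -> Omega)
    (g : T -> k.+2.-tuple R) :
  measurable_fun setT f -> measurable_fun setT g ->
  measurable_fun setT (fun x => weakly_exceed (f x) (g x)).
Proof.
move=> mf mg; pose E := [set p : T * k.+2.-tuple R |
  fBm0 (f p.1) (g p.1) <= fBm0 (f p.1) p.2].
have mE : measurable E.
  apply: measurable_set_le; apply: measurable_fBm0 => //;
    exact: measurableT_comp.
have := measurable_fun_xsection nu mE; apply: eq_measurable_fun => x _ /=.
by congr (nu _); apply/seteqP; split => s; rewrite /xsection/= inE.
Qed.

(** Tonelli on the set of ties with [t]: sections at [s <> t] are null for [P], and the single point
    [t] is null for [nu]. The null set depends on [t]. *)
Lemma ae_exceedE t : S t ->
  exists N, [/\ measurable N, P N = 0%E &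
    forall w, ~ N w -> weakly_exceed w t = exceed w t].
Proof.
move=> St; pose E := [set p : Omega * k.+2.-tuple R |
  S p.2 /\ fBm0 p.1 p.2 = fBm0 p.1 t].
have mS : measurable [set p : Omega * k.+2.-tuple R | S p.2].
  rewrite -[X in measurable X]setTI.
  exact: (@measurable_snd _ _ _ _ measurableT _ (@measurable_sphere R k.+1)).
have mEq : measurable [set p : Omega * k.+2.-tuple R | fBm0 p.1 p.2 = fBm0 p.1 t].
  rewrite (_ : [set p | _] = [set p | fBm0 p.1 p.2 <= fBm0 p.1 t] `&`
      [set p | fBm0 p.1 t <= fBm0 p.1 p.2]).
    by apply: measurableI; apply: measurable_set_le; apply: measurable_fBm0.
  by apply/seteqP; split => p /= => [->|[h1 h2]]; [rewrite lexx|apply/le_anti/andP].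
have mE : measurable E := measurableI _ _ mS mEq.
have tie0 : (\int[P]_w nu (xsection E w) = 0)%E.
  rewrite (integral_section_swap P nu mE).
  rewrite (@ge0_negligible_integral _ _ _ nu setT [set t])//.
  - apply: integral0_eq => s [_ /= /eqP st].
    have [Ss|nSs] := pselect (S s); last first.
      rewrite (_ : ysection E s = set0) ?measure0// -subset0 => w.
      by rewrite /ysection/= inE => -[].
    rewrite -(fBm_tie Ss St (elimN eqP st)); congr (P _).
    by apply/seteqP; split => w; rewrite /ysection/= inE /E/= !fBm0E// => -[].
  - exact: measurable_tuple_set1.
  - exact: measurable_fun_ysection.
  - exact: cone_prob_set1.
have mtie : measurable_fun setT (fun w => nu (xsection E w)).
  exact: measurable_fun_xsection.
have abs0 : (\int[P]_w `|nu (xsection E w)| = 0)%E.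
  by rewrite -[RHS]tie0; apply: eq_integral => w _; rewrite gee0_abs.
have [N [mN N0 subN]] := (ae_eq_integral_abs P measurableT mtie).1 abs0.
exists N; split; [exact: mN|exact: N0|move=> w nNw].
have {subN nNw} nuE : nu (xsection E w) = 0%E.
  by apply: contrapT => h; apply: nNw; apply: subN => /= /(_ Logic.I).
apply/eqP; rewrite eq_le; apply/andP; split; last first.
  apply: le_measure; rewrite ?inE.
  - exact: measurable_exceed_set.
  - by apply: measurable_set_le; exact: measurable_fBm0.
  - by move=> s /=; exact: ltW.
(* Restricted to the sphere, the weak inequality splits into the strict one and the tie section,
   which is null. *)
rewrite /weakly_exceed -cone_prob_sphereI.
apply: (@le_trans _ _ (nu ([set s | fBm0 w t < fBm0 w s] `|` xsection E w))).
  apply: le_measure; rewrite ?inE.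
  - apply: measurableI; last exact: measurable_sphere.
    by apply: measurable_set_le; exact: measurable_fBm0.
  - apply: measurableU; first exact: measurable_exceed_set.
    exact: measurable_xsection.
  - move=> s /= []; rewrite le_eqVlt => /predU1P[ts|ts] Ss; [right|by left].
    by rewrite /xsection/= inE.
apply: (@le_trans _ _
    (nu [set s | (fBm0 w t < fBm0 w s)%R] + nu (xsection E w))%E); last first.
  by rewrite nuE adde0.
apply: measureU2; first exact: measurable_exceed_set.
exact: measurable_xsection.
Qed.

Lemma probability_le_null (A B N : set Omega) : measurable A -> measurable B ->
  measurable N -> P N = 0%E -> A `<=` B `|` N -> (P A <= P B)%E.
Proof.
move=> mA mB mN N0 AB; apply: (@le_trans _ _ (P (B `|` N))).
  by apply: le_measure; rewrite ?inE//; exact: measurableU.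
apply: (@le_trans _ _ (P B + P N)%E); first exact: measureU2.
by rewrite N0 adde0.
Qed.

(** Tonelli, with [nu] carried by the sphere. [F] is kept general to cover both strict and weak
    ranks. *)
Lemma exceed_sphere_average (F : Omega -> k.+2.-tuple R -> \bar R) (a q : \bar R) :
  measurable_fun setT (fun p : Omega * k.+2.-tuple R => F p.1 p.2) ->
  (forall t, S t -> P [set w | (a < F w t)%E] = q) ->
  (\int[P]_w nu [set t | (a < F w t)%E] = q)%E.
Proof.
move=> mF Fq; pose B := [set p : Omega * k.+2.-tuple R | (a < F p.1 p.2)%E].
have mB : measurable B by apply: measurable_ereal_gt.
have := integral_section_swap P nu mB.
rewrite (_ : (\int[P]_w _)%E = (\int[P]_w nu [set t | (a < F w t)%E])%E); last first.
  by apply: eq_integral => w _; congr (nu _); apply/seteqP; split => t;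
    rewrite /xsection/= inE.
(* Nonnegativity of [q] is read off at an explicit point of the sphere, the normalised all-ones
   vector. *)
move=> ->; have q0 : (0 <= q)%E.
  by rewrite -(Fq (normalize [tuple 1 | i < k.+2]))// /sphere/= dotR_normalize//;
    rewrite /dotR big_ord_recl tnth_mktuple mulr1 ltr_pwDl// sumr_ge0// => i _;
    exact: sqr_ge0.
have mS := @measurable_sphere R k.+1.
have nuSC : nu (~` S) = 0%E.
  rewrite -cone_prob_sphereI (_ : _ `&` _ = set0) ?measure0//.
  by apply/seteqP; split => // s [].
rewrite (@ge0_negligible_integral _ _ _ nu setT (~` S))//.
- rewrite setDE setCK setTI.
  rewrite (eq_integral (fun=> q)); last first.
    move=> t /set_mem St; rewrite -(Fq t St); congr (P _).
    by apply/seteqP; split => w; rewrite /ysection/= inE.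
  have nuS : nu S = 1%E.
    by rewrite -[S]setTI cone_prob_sphereI; exact: (probability_setT nu).
  by rewrite integral_cst// [X in (_ * X)%E]nuS mule1.
- exact: measurableC.
- exact: measurable_fun_ysection.
Qed.

Lemma measurable_section_gt (F : Omega -> k.+2.-tuple R -> \bar R) (a : \bar R) :
  measurable_fun setT (fun p : Omega * k.+2.-tuple R => F p.1 p.2) ->
  measurable_fun setT (fun w => nu [set t | (a < F w t)%E]).
Proof.
move=> mF; pose B := [set p : Omega * k.+2.-tuple R | (a < F p.1 p.2)%E].
have mB : measurable B by apply: measurable_ereal_gt.
have := measurable_fun_xsection nu mB; apply: eq_measurable_fun => w _ /=.
by congr (nu _); apply/seteqP; split => t; rewrite /xsection/= inE.
Qed.

(** A sandwich with no path free of ties: for every path the strict ranks give at most [1 - a] and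
    the weak ranks at least [1 - a]. After averaging over [P] both equal the same probability. *)
Lemma exceed_uniform t (a : R) : S t -> 0 <= a <= 1 ->
  P [set w | (a%:E < exceed w t)%E] = (1 - a)%:E.
Proof.
move=> St /andP[a0 a1].
have mG : measurable_fun setT (fun p : Omega * k.+2.-tuple R => exceed p.1 p.2).
  exact: measurable_exceed.
have mW : measurable_fun setT (fun p : Omega * k.+2.-tuple R => weakly_exceed p.1 p.2).
  exact: measurable_weakly_exceed.
(* Weak and strict ranks at the fixed point [s] agree almost surely; constancy of the law then moves
   [s] to [t]. *)
have weak s : S s -> P [set w | (a%:E < weakly_exceed w s)%E] =
    P [set w | (a%:E < exceed w t)%E].
  move=> Ss; apply: etrans (exceed_law_constant a Ss St).
  have [N [mN N0 NE]] := ae_exceedE Ss.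
  have mA : measurable [set w | (a%:E < weakly_exceed w s)%E].
    by apply: measurable_ereal_gt; exact: measurable_weakly_exceed.
  have mB : measurable [set w | (a%:E < exceed w s)%E].
    by apply: measurable_ereal_gt; exact: measurable_exceed.
  apply/eqP; rewrite eq_le; apply/andP; split.
    apply: (probability_le_null mA mB mN N0) => w /= aw.
    by have [Nw|nNw] := pselect (N w); [right|left; rewrite -NE].
  apply: (probability_le_null mB mA mN N0) => w /= aw.
  by have [Nw|nNw] := pselect (N w); [right|left; rewrite NE].
apply/eqP; rewrite eq_le; apply/andP; split.
- rewrite -(exceed_sphere_average mG (fun s Ss => exceed_law_constant a Ss St)).
  apply: (@le_trans _ _ (\int[P]_w (1 - a)%:E)%E); last first.
    by rewrite integral_cst// [X in (_ * X)%E]probability_setT mule1.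
  apply: ge0_le_integral.
  + exact: measurableT.
  + by move=> w _; exact: measure_ge0.
  + exact: measurable_section_gt mG.
  + exact: measurable_cst.
  + move=> w _; apply: (rank_gt_quantile nu); last exact: a1.
    exact: measurable_fBm0.
- rewrite -(exceed_sphere_average mW weak).
  apply: (@le_trans _ _ (\int[P]_w (1 - a)%:E)%E).
    by rewrite integral_cst// [X in (_ * X)%E]probability_setT mule1.
  apply: ge0_le_integral.
  + exact: measurableT.
  + by move=> w _; rewrite lee_fin subr_ge0.
  + exact: measurable_cst.
  + exact: measurable_section_gt mW.
  + move=> w _; apply: (rank_ge_quantile nu); last exact: a0.
    exact: measurable_fBm0.
Qed.

End SphericalFBm.

(** Since [fBm0] is 0 off the sphere, its positivity set already lies in the sphere and is
    measurable for every [w]. *)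
Lemma positive_fractionE (R : realType) k (dO : measure_display)
    (Omega : measurableType dO) (X : Omega -> k.+2.-tuple R -> R) w :
  measurable_fun (setT `*` @sphere R k.+2)
    (fun p : Omega * k.+2.-tuple R => X p.1 p.2) ->
  (positive_fraction X w)%:E = cone_prob [set s | 0 < fBm0 X w s].
Proof.
move=> mX; have mA : measurable [set s | 0 < fBm0 X w s].
  by apply: measurable_set_lt => //; exact: (measurable_fBm0 mX).
have AE : [set s | sphere k.+2 s /\ 0 < X w s] = [set s | 0 < fBm0 X w s].
  apply/seteqP; split => s /= => [[Ss]|]; first by rewrite fBm0E.
  rewrite /fBm0 patchE; case: ifP => [/set_mem[_ Ss] //|_].
  by rewrite ltxx.
rewrite /positive_fraction AE surface_fraction//.
  by rewrite fineK//; exact: (fin_num_measure (@cone_prob R k.+1)).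
by rewrite -AE => s [].
Qed.

Theorem mainTheorem4 (R : realType) (d : nat) (H : R)
    (dO : measure_display) (Omega : measurableType dO)
    (P : probability Omega R) (O : d.-tuple R)
    (X : Omega -> d.-tuple R -> R) :
  (2 <= d)%N -> 0 < H <= 1 / 2 ->
  spherical_fBm P H O X ->
  measurable_fun (setT `*` sphere d) (fun p : Omega * d.-tuple R => X p.1 p.2) ->
  forall a : R, 0 <= a <= 1 ->
    P [set w | positive_fraction X w <= a] = a%:E.
Proof.
(* Dimensions 0 and 1 are ruled out by [2 <= d]; from [k.+2] on, single points are null for
   [cone_prob]. *)
case: d O X => [|[|k]]// O X _ _ [SO gX [N [mN N0 NO]] incX] mX a a01.
pose B := [set w | (a%:E < cone_prob [set s | (0 < fBm0 X w s)%R])%E].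
pose C := [set w | (a%:E < exceed X w O)%E].
have mB : measurable B.
  apply: measurable_ereal_gt.
  have mE : measurable [set p : Omega * k.+2.-tuple R | 0 < fBm0 X p.1 p.2].
    by apply: measurable_set_lt => //; exact: (measurable_fBm0 mX).
  have := measurable_fun_xsection (@cone_prob R k.+1) mE.
  apply: eq_measurable_fun => w _ /=.
  by congr cone_prob; apply/seteqP; split => s; rewrite /xsection/= inE.
have mC : measurable C.
  by apply: measurable_ereal_gt; exact: (measurable_exceed mX).
have BC w : ~ N w -> cone_prob [set s | 0 < fBm0 X w s] = exceed X w O.
  move=> nNw; have XO : X w O = 0 by apply: contrapT => h; apply: nNw; exact: NO.
  by rewrite /exceed fBm0E// XO.
have PB : P B = (1 - a)%:E.
  rewrite -(exceed_uniform gX incX mX SO a01).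
  apply/eqP; rewrite eq_le; apply/andP; split.
    apply: (probability_le_null mB mC mN N0) => w /= aw.
    by have [Nw|nNw] := pselect (N w); [right|left; rewrite /C/= -BC].
  apply: (probability_le_null mC mB mN N0) => w /= aw.
  by have [Nw|nNw] := pselect (N w); [right|left; rewrite /B/= BC].
(* The distribution function at [a] is the complement of the tail [B]. *)
rewrite (_ : [set w | _] = ~` B).
  by rewrite probability_setC// PB -EFinB; congr EFin; lra.
apply/seteqP; split => w; rewrite /B/= -positive_fractionE// lte_fin leNgt => /negP//.
Qed.
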